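(* Let $\Gamma_{\{3,4,3,4\}}$ be the group of isometries of $\mathbf H^1_{\mathbb H}$ generated by the hyperbolic reflections in the five 3-dimensional faces of the hyperbolic 4-simplex $\Delta_{\mathfrak L}$ with vertices $A=1$, $B=\frac12(\sqrt3+\mathbf i)$, $C=\frac1{\sqrt2}+\frac12(\mathbf i+\mathbf j)$, $D=\frac12(1+\mathbf i+\mathbf j+\mathbf k)$ and the ideal vertex $\infty$. Then $\Gamma_{\{3,4,3,4\}}$ is a discrete group of finite covolume, and $$PSL(2,\mathfrak L)\subset PSL(2,\mathfrak H)\subset\Gamma_{\{3,4,3,4\}}$$ with $[\Gamma_{\{3,4,3,4\}}:PSL(2,\mathfrak H)]=4$, $[\Gamma_{\{3,4,3,4\}}:PSL(2,\mathfrak L)]=12$ and $[PSL(2,\mathfrak H):PSL(2,\mathfrak L)]=3$.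
   Context: $\mathbf H^1_{\mathbb H}=\{q\in\mathbb H:\Re q>0\}$ with the hyperbolic metric $|dq|^2/(\Re q)^2$ (a model of real hyperbolic 4-space, with ideal boundary $\{\Re q=0\}\cup\{\infty\}$). $T(q)=q^{-1}$, $\tau_\omega(q)=q+\omega$. $PSL(2,\mathfrak L)$ is generated by $T$ and $\tau_\omega$ for $\omega\in\{b\mathbf i+c\mathbf j+d\mathbf k:b,c,d\in\mathbb Z\}$. $PSL(2,\mathfrak H)$ is generated by $T$, these $\tau_\omega$, and the maps $q\mapsto uqu^{-1}$ for the 24 Hurwitz units $u\in\{\pm1,\pm\mathbf i,\pm\mathbf j,\pm\mathbf k,\frac12(\pm1\pm\mathbf i\pm\mathbf j\pm\mathbf k)\}$. (The dihedral angles of $\Delta_{\mathfrak L}$ are $\pi/2,\pi/3,\pi/4$, its Coxeter diagram being the linear diagram with labels $3,4,3,4$.) *)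

(* Defs.v *)
From Stdlib Require Import Reals Lra List.
Open Scope R_scope.

Record quat := Q { qr : R; qi : R; qj : R; qk : R }.

Definition qadd (p q : quat) : quat :=
  Q (qr p + qr q) (qi p + qi q) (qj p + qj q) (qk p + qk q).

Definition qmul (p q : quat) : quat :=
  Q (qr p * qr q - qi p * qi q - qj p * qj q - qk p * qk q)
    (qr p * qi q + qi p * qr q + qj p * qk q - qk p * qj q)
    (qr p * qj q - qi p * qk q + qj p * qr q + qk p * qi q)
    (qr p * qk q + qi p * qj q - qj p * qi q + qk p * qr q).

Definition qnorm2 (q : quat) : R :=
  qr q * qr q + qi q * qi q + qj q * qj q + qk q * qk q.

(** Inverse q^{-1} = conj(q)/|q|^2 (junk value at q = 0). *)
Definition qinv (q : quat) : quat :=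
  let n := qnorm2 q in
  Q (qr q / n) (- qi q / n) (- qj q / n) (- qk q / n).

Definition qdist2 (p q : quat) : R :=
  (qr p - qr q)^2 + (qi p - qi q)^2 + (qj p - qj q)^2 + (qk p - qk q)^2.

(** * The half-space H^1_H = { q : Re q > 0 } with metric |dq|^2/(Re q)^2 *)
Definition inH (q : quat) : Prop := 0 < qr q.

(** Hyperbolic distance: cosh d = 1 + |p - q|^2 / (2 Re p Re q),
    d = arcosh(1+delta) = ln(1 + delta + sqrt(delta (delta + 2))). *)
Definition hdist (p q : quat) : R :=
  let delta := qdist2 p q / (2 * qr p * qr q) in
  ln (1 + delta + sqrt (delta * (delta + 2))).

(** Maps are represented as functions quat -> quat; only their restriction
    to H matters, so maps are compared by agreement on H. *)
Definition eqH (f g : quat -> quat) : Prop := forall q, inH q -> f q = g q.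

Definition compose (f g : quat -> quat) : quat -> quat := fun q => f (g q).

Definition isometry (f : quat -> quat) : Prop :=
  (forall q, inH q -> inH (f q)) /\
  (forall p q, inH p -> inH q -> hdist (f p) (f q) = hdist p q) /\
  (forall y, inH y -> exists x, inH x /\ f x = y).

(** Finite compositions of generators (a monoid closure; all generating sets
    below are closed under inverses on H, so this is the generated group). *)
Inductive words (S : (quat -> quat) -> Prop) : (quat -> quat) -> Prop :=
| words_id : words S (fun q => q)
| words_cons : forall s w, S s -> words S w -> words S (compose s w).

Definition generated (S : (quat -> quat) -> Prop) (f : quat -> quat) : Prop :=
  exists w, words S w /\ eqH f w.

Definition T_map (q : quat) : quat := qinv q.
Definition tau (w : quat) (q : quat) : quat := qadd q w.
Definition conj_by (u : quat) (q : quat) : quat := qmul (qmul u q) (qinv u).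

Definition lipschitz_imag (w : quat) : Prop :=
  qr w = 0 /\ exists b c d : Z, qi w = IZR b /\ qj w = IZR c /\ qk w = IZR d.

Definition pm1 (x : R) : Prop := x = 1 \/ x = -1.
Definition hurwitz_unit (u : quat) : Prop :=
  (pm1 (qr u) /\ qi u = 0 /\ qj u = 0 /\ qk u = 0) \/
  (qr u = 0 /\ pm1 (qi u) /\ qj u = 0 /\ qk u = 0) \/
  (qr u = 0 /\ qi u = 0 /\ pm1 (qj u) /\ qk u = 0) \/
  (qr u = 0 /\ qi u = 0 /\ qj u = 0 /\ pm1 (qk u)) \/
  (pm1 (2 * qr u) /\ pm1 (2 * qi u) /\ pm1 (2 * qj u) /\ pm1 (2 * qk u)).

Definition gens_PSL2L (f : quat -> quat) : Prop :=
  f = T_map \/ exists w, lipschitz_imag w /\ f = tau w.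

Definition gens_PSL2H (f : quat -> quat) : Prop :=
  gens_PSL2L f \/ exists u, hurwitz_unit u /\ f = conj_by u.

Definition PSL2L : (quat -> quat) -> Prop := generated gens_PSL2L.
Definition PSL2H : (quat -> quat) -> Prop := generated gens_PSL2H.

Definition vA : quat := Q 1 0 0 0.
Definition vB : quat := Q (sqrt 3 / 2) (1/2) 0 0.
Definition vC : quat := Q (1 / sqrt 2) (1/2) (1/2) 0.
Definition vD : quat := Q (1/2) (1/2) (1/2) (1/2).

(** The vertical geodesic through P, ending at the ideal vertex infinity. *)
Definition vline (P : quat) (q : quat) : Prop :=
  0 < qr q /\ qi q = qi P /\ qj q = qj P /\ qk q = qk P.

(** Point sets spanning (hyperbolically) the hyperplanes of the five 3-faces:
    the face opposite infinity is spanned by A, B, C, D; the face opposite a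
    finite vertex V is spanned by the vertical geodesics from the other three
    finite vertices to infinity. *)
Definition face_opp_inf (q : quat) : Prop := q = vA \/ q = vB \/ q = vC \/ q = vD.
Definition face_opp_A (q : quat) : Prop := vline vB q \/ vline vC q \/ vline vD q.
Definition face_opp_B (q : quat) : Prop := vline vA q \/ vline vC q \/ vline vD q.
Definition face_opp_C (q : quat) : Prop := vline vA q \/ vline vB q \/ vline vD q.
Definition face_opp_D (q : quat) : Prop := vline vA q \/ vline vB q \/ vline vC q.

(** The hyperbolic reflection in the hyperplane spanned by S: the non-trivial
    isometry of H fixing S pointwise (unique on H). *)
Definition reflection_in (S : quat -> Prop) (f : quat -> quat) : Prop :=
  isometry f /\ (forall q, S q -> f q = q) /\ (exists q, inH q /\ f q <> q).

Definition gens_Gamma (f : quat -> quat) : Prop :=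
  reflection_in face_opp_inf f \/ reflection_in face_opp_A f \/
  reflection_in face_opp_B f \/ reflection_in face_opp_C f \/
  reflection_in face_opp_D f.

Definition Gamma3434 : (quat -> quat) -> Prop := generated gens_Gamma.

(** Discrete in Isom(H) with the compact-open topology: the identity has a
    basic neighbourhood {g : d(gx, x) < eps for all x in the closed ball
    B(p, R)} meeting G only in the identity. *)
Definition discrete_group (G : (quat -> quat) -> Prop) : Prop :=
  exists p Rad eps, inH p /\ 0 < Rad /\ 0 < eps /\
    forall g, G g ->
      (forall x, inH x -> hdist x p <= Rad -> hdist (g x) x < eps) ->
      eqH g (fun q => q).

(** Closed Euclidean boxes in H, and their hyperbolic volume
    (integral of dx0 dx1 dx2 dx3 / x0^4). *)
Record box := Box { lo0 : R; hi0 : R; lo1 : R; hi1 : R;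
                    lo2 : R; hi2 : R; lo3 : R; hi3 : R }.
Definition valid_box (b : box) : Prop :=
  0 < lo0 b <= hi0 b /\ lo1 b <= hi1 b /\ lo2 b <= hi2 b /\ lo3 b <= hi3 b.
Definition in_box (b : box) (q : quat) : Prop :=
  lo0 b <= qr q <= hi0 b /\ lo1 b <= qi q <= hi1 b /\
  lo2 b <= qj q <= hi2 b /\ lo3 b <= qk q <= hi3 b.
Definition hvol_box (b : box) : R :=
  (/ (lo0 b)^3 - / (hi0 b)^3) / 3 *
  ((hi1 b - lo1 b) * (hi2 b - lo2 b) * (hi3 b - lo3 b)).

Definition open_set (U : quat -> Prop) : Prop :=
  forall x, U x -> exists e, 0 < e /\ forall y, qdist2 y x < e -> U y.

(** Hyperbolic volume of an open set U is at most M (inner Jordan content,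
    which equals the Lebesgue measure for open sets). *)
Definition hvol_le (U : quat -> Prop) (M : R) : Prop :=
  forall bs : list box,
    (forall b, In b bs -> valid_box b /\ forall q, in_box b q -> U q) ->
    (forall i j, (i < length bs)%nat -> (j < length bs)%nat -> i <> j ->
       forall q, ~ (in_box (nth i bs (Box 1 1 0 0 0 0 0 0)) q /\
                    in_box (nth j bs (Box 1 1 0 0 0 0 0 0)) q)) ->
    fold_right Rplus 0 (map hvol_box bs) <= M.

(** Finite covolume: some open subset of H of finite hyperbolic volume has
    G-translates covering H (equivalently vol(H/G) < infinity). *)
Definition finite_covolume (G : (quat -> quat) -> Prop) : Prop :=
  exists U M, open_set U /\ (forall q, U q -> inH q) /\ hvol_le U M /\
    forall y, inH y -> exists g x, G g /\ U x /\ g x = y.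

Definition subgroup (K G : (quat -> quat) -> Prop) : Prop :=
  forall f, K f -> G f.

Definition index_eq (G K : (quat -> quat) -> Prop) (n : nat) : Prop :=
  exists r : nat -> (quat -> quat),
    (forall i, (i < n)%nat -> G (r i)) /\
    (forall g, G g -> exists i k, (i < n)%nat /\ K k /\ eqH g (compose (r i) k)) /\
    (forall i j k k', (i < n)%nat -> (j < n)%nat -> i <> j -> K k -> K k' ->
       ~ eqH (compose (r i) k) (compose (r j) k')).

(* Main.v *)
Require Import Defs.
From Stdlib Require Import Reals Lra Lia ZArith List Bool.
From Coquelicot Require Import Coquelicot.

(** In the coordinates X(q) = (1/Re q, |q|^2/Re q, Im q/Re q) the half-space is a sheet of
    the hyperboloid a n - |u|^2 = 1, distances are given by the polar form, and the five
    reflections act by integral matrices. Twice cosh d - 1 is then an integer between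
    points with integral coordinates, so an element of Gamma that moves five spanning
    integral points by little fixes them: Gamma is discrete. The stabilizer of infinity
    contains Z^3 extended by the signed permutations; translating into the cube
    |x_i| <= 1/2 and inverting raises every point into a region of finite volume.
    PSL(2,L) contains the even sign changes and is normalized by the signed permutations,
    and every element of Gamma is a signed permutation times an element of PSL(2,L). The
    determinant of the action on X and the permutation induced on the radical of the
    form modulo 2 are trivial on PSL(2,L) and separate the remaining twelve cosets. *)

Open Scope R_scope.

(** The reflections are specified only as nontrivial isometries fixing a face pointwise, and only
    their values on the half-space count; their formulas must be derived before anything can be
    computed. Each index is then squeezed: a normal form bounds the number of cosets from above,
    invariants bound it from below. The 48 signed permutations modulo the 4 even sign changes leave
    12 classes, the index over PSL(2,L). The Hurwitz units contribute the cyclic permutations of the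
    axes, whence the factors 3 and 4. One invariant alone cannot reach 12: the determinant is -1 on
    an odd permutation as well as on an odd sign change, and the permutation of the radical does not
    see signs at all. *)

Definition Xa (q : quat) : R := / qr q.
Definition Xn (q : quat) : R := qnorm2 q / qr q.

Inductive axis := I1 | I2 | I3.

Definition coord (q : quat) (i : axis) : R :=
  match i with I1 => qi q | I2 => qj q | I3 => qk q end.

Definition Xu (i : axis) (q : quat) : R := coord q i / qr q.

Definition delta (p q : quat) : R := qdist2 p q / (2 * qr p * qr q).

Lemma quat_ext (p q : quat) :
  qr p = qr q -> qi p = qi q -> qj p = qj q -> qk p = qk q -> p = q.
Proof. destruct p, q; simpl; intros; subst; reflexivity. Qed.

Lemma coord_ext (p q : quat) : qr p = qr q -> (forall i, coord p i = coord q i) -> p = q.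
Proof.
intros Hr Hc; apply quat_ext; [exact Hr | exact (Hc I1) | exact (Hc I2) | exact (Hc I3)].
Qed.

Lemma Xa_pos (q : quat) : inH q -> 0 < Xa q.
Proof. apply Rinv_0_lt_compat. Qed.

Lemma qnorm2_pos (q : quat) : inH q -> 0 < qnorm2 q.
Proof. unfold inH, qnorm2; intros; nra. Qed.

Lemma X_quadric (q : quat) : inH q ->
  Xa q * Xn q = 1 + Xu I1 q * Xu I1 q + Xu I2 q * Xu I2 q + Xu I3 q * Xu I3 q.
Proof.
unfold inH, Xa, Xn, Xu, qnorm2; simpl; intros H; field; lra.
Qed.

Lemma Xa_qr (p q : quat) : Xa p = Xa q -> qr p = qr q.
Proof. unfold Xa; intros H; rewrite <- (Rinv_inv (qr p)), H; apply Rinv_inv. Qed.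

Lemma X_inj (p q : quat) : inH p -> inH q ->
  Xa p = Xa q -> (forall i, Xu i p = Xu i q) -> p = q.
Proof.
unfold inH, Xu; intros Hp Hq Ha Hu.
apply Xa_qr in Ha; apply coord_ext; [exact Ha |].
intros i; specialize (Hu i); rewrite Ha in Hu.
apply (Rmult_eq_reg_r (/ qr q)); [exact Hu | apply Rinv_neq_0_compat; lra].
Qed.

Lemma delta_X (p q : quat) : inH p -> inH q ->
  delta p q = (Xa p * Xn q + Xn p * Xa q) / 2 - Xu I1 p * Xu I1 q
              - Xu I2 p * Xu I2 q - Xu I3 p * Xu I3 q - 1.
Proof.
unfold inH, delta, qdist2, Xa, Xn, Xu, qnorm2; simpl; intros Hp Hq; field; lra.
Qed.

Lemma delta_nonneg (p q : quat) : inH p -> inH q -> 0 <= delta p q.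
Proof.
unfold inH, delta; intros Hp Hq; unfold Rdiv; apply Rmult_le_pos.
- pose proof (pow2_ge_0 (qr p - qr q)); pose proof (pow2_ge_0 (qi p - qi q)).
  pose proof (pow2_ge_0 (qj p - qj q)); pose proof (pow2_ge_0 (qk p - qk q)).
  unfold qdist2; lra.
- apply Rlt_le, Rinv_0_lt_compat; nra.
Qed.

Lemma delta_eq_0 (p q : quat) : inH p -> inH q -> delta p q = 0 -> p = q.
Proof.
unfold inH, delta; intros Hp Hq H.
assert (H0 : qdist2 p q = 0).
{ replace (qdist2 p q) with (qdist2 p q / (2 * qr p * qr q) * (2 * qr p * qr q))
    by (field; lra).
  rewrite H; ring. }
unfold qdist2 in H0.
pose proof (pow2_ge_0 (qr p - qr q)); pose proof (pow2_ge_0 (qi p - qi q)).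
pose proof (pow2_ge_0 (qj p - qj q)); pose proof (pow2_ge_0 (qk p - qk q)).
apply quat_ext; apply Rminus_diag_uniq; apply Rsqr_0_uniq; rewrite Rsqr_pow2; lra.
Qed.

Definition arcosh1 (x : R) : R := ln (1 + x + sqrt (x * (x + 2))).

Lemma hdist_delta (p q : quat) : hdist p q = arcosh1 (delta p q).
Proof. reflexivity. Qed.

Lemma arcosh1_lt (x y : R) : 0 <= x -> x < y -> arcosh1 x < arcosh1 y.
Proof.
intros Hx Hxy; unfold arcosh1.
assert (sqrt (x * (x + 2)) < sqrt (y * (y + 2))) by (apply sqrt_lt_1; nra).
assert (0 <= sqrt (x * (x + 2))) by apply sqrt_pos.
apply ln_increasing; lra.
Qed.

(** [arcosh1] is strictly increasing on nonnegative reals, so distance determines [delta]. Metric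
    information is used in this form because, unlike the distance, [delta] is bilinear in the
    X-coordinates up to a constant. *)
Lemma hdist_eq (p q p' q' : quat) : inH p -> inH q -> inH p' -> inH q' ->
  hdist p q = hdist p' q' -> delta p q = delta p' q'.
Proof.
rewrite !hdist_delta; intros Hp Hq Hp' Hq' H.
destruct (Rtotal_order (delta p q) (delta p' q')) as [L | [L | L]]; [| exact L |];
  apply arcosh1_lt in L; try apply delta_nonneg; trivial; lra.
Qed.

(** * Isometries of the half-space *)

Definition preservesH (f : quat -> quat) : Prop := forall q, inH q -> inH (f q).

Lemma isometry_preservesH (f : quat -> quat) : isometry f -> preservesH f.
Proof. intros [H _]; exact H. Qed.

Lemma isometry_delta (f : quat -> quat) (p q : quat) : isometry f -> inH p -> inH q ->
  delta (f p) (f q) = delta p q.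
Proof.
intros (HH & Hd & _) Hp Hq; apply hdist_eq; auto.
Qed.

Lemma isometry_compose (f g : quat -> quat) :
  isometry f -> isometry g -> isometry (compose f g).
Proof.
intros (f1 & f2 & f3) (g1 & g2 & g3); unfold compose; repeat split.
- auto.
- intros p q Hp Hq; rewrite f2, g2; auto.
- intros y Hy; destruct (f3 y Hy) as (x & Hx & <-); destruct (g3 x Hx) as (z & Hz & <-).
  exists z; auto.
Qed.

Lemma isometry_eqH (f g : quat -> quat) : eqH f g -> isometry g -> isometry f.
Proof.
intros E (g1 & g2 & g3); repeat split.
- intros q Hq; rewrite E; auto.
- intros p q Hp Hq; rewrite !E; auto.
- intros y Hy; destruct (g3 y Hy) as (x & Hx & <-); exists x; auto.
Qed.

Lemma isometry_id : isometry (fun q => q).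
Proof. repeat split; auto; intros y Hy; exists y; auto. Qed.

Lemma involution_isometry (f : quat -> quat) : preservesH f ->
  (forall q, inH q -> f (f q) = q) ->
  (forall p q, inH p -> inH q -> delta (f p) (f q) = delta p q) -> isometry f.
Proof.
intros HH Hi Hd; repeat split; auto.
- intros p q Hp Hq; rewrite !hdist_delta, Hd; auto.
- intros y Hy; exists (f y); auto.
Qed.

(** * The five reflections *)

Definition s_inf (q : quat) : quat :=
  Q (qr q / qnorm2 q) (qi q / qnorm2 q) (qj q / qnorm2 q) (qk q / qnorm2 q).
Definition s_A (q : quat) : quat := Q (qr q) (1 - qi q) (qj q) (qk q).
Definition s_B (q : quat) : quat := Q (qr q) (qj q) (qi q) (qk q).
Definition s_C (q : quat) : quat := Q (qr q) (qi q) (qk q) (qj q).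
Definition s_D (q : quat) : quat := Q (qr q) (qi q) (qj q) (- qk q).

Lemma s_inf_preservesH : preservesH s_inf.
Proof.
intros q Hq; unfold inH; simpl; apply Rdiv_lt_0_compat; auto using qnorm2_pos.
Qed.

Lemma qnorm2_s_inf (q : quat) : inH q -> qnorm2 (s_inf q) = / qnorm2 q.
Proof.
intros Hq; pose proof (qnorm2_pos q Hq) as H; unfold s_inf.
replace (qnorm2 (Q _ _ _ _)) with (qnorm2 q / (qnorm2 q * qnorm2 q)).
- field; lra.
- set (n := qnorm2 q) in *; unfold qnorm2 at 1; simpl; unfold n at 1, qnorm2; field; lra.
Qed.

Lemma Xa_s_inf (q : quat) : inH q -> Xa (s_inf q) = Xn q.
Proof.
intros Hq; pose proof (qnorm2_pos q Hq); unfold inH in Hq.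
unfold Xa, Xn; simpl; field; lra.
Qed.

Lemma Xn_s_inf (q : quat) : inH q -> Xn (s_inf q) = Xa q.
Proof.
intros Hq; pose proof (qnorm2_pos q Hq).
unfold Xn; rewrite qnorm2_s_inf by trivial; unfold inH in Hq; unfold Xa; simpl; field; lra.
Qed.

Lemma Xu_s_inf (q : quat) (i : axis) : inH q -> Xu i (s_inf q) = Xu i q.
Proof.
intros Hq; pose proof (qnorm2_pos q Hq); unfold inH in Hq.
destruct i; unfold Xu; simpl; field; lra.
Qed.

Lemma s_inf_involutive (q : quat) : inH q -> s_inf (s_inf q) = q.
Proof.
intros Hq; pose proof (s_inf_preservesH q Hq) as H1; pose proof (s_inf_preservesH _ H1).
apply X_inj; trivial.
- rewrite Xa_s_inf, Xn_s_inf; auto.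
- intros i; rewrite !Xu_s_inf; auto.
Qed.

Lemma s_inf_isometry : isometry s_inf.
Proof.
apply involution_isometry.
- exact s_inf_preservesH.
- exact s_inf_involutive.
- intros p q Hp Hq; pose proof (s_inf_preservesH p Hp); pose proof (s_inf_preservesH q Hq).
  rewrite !delta_X, !Xa_s_inf, !Xn_s_inf, !Xu_s_inf by trivial; field.
Qed.

Ltac vertical_isometry :=
  apply involution_isometry;
  [ intros q Hq; exact Hq
  | intros q Hq; apply quat_ext; simpl; ring
  | intros p q Hp Hq; unfold delta; f_equal; unfold qdist2; simpl; ring ].

Lemma s_A_isometry : isometry s_A. Proof. vertical_isometry. Qed.
Lemma s_B_isometry : isometry s_B. Proof. vertical_isometry. Qed.
Lemma s_C_isometry : isometry s_C. Proof. vertical_isometry. Qed.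
Lemma s_D_isometry : isometry s_D. Proof. vertical_isometry. Qed.

(* If f agrees at each point with r or with the identity and moves one point q0,
   then f = r: a point q fixed by f but not by r would be equidistant from q0 and
   r q0, hence on the mirror of r. *)
Lemma reflection_unique (f r : quat -> quat) : isometry f ->
  (exists q, inH q /\ f q <> q) ->
  (forall q, inH q -> f q = q \/ f q = r q) ->
  (forall q q0, inH q -> inH q0 -> r q0 <> q0 -> delta q (r q0) = delta q q0 -> r q = q) ->
  eqH f r.
Proof.
intros Hf (q0 & H0 & N0) Hr Hw q Hq.
destruct (Hr q0 H0) as [E0 | E0]; [contradiction |].
destruct (Hr q Hq) as [E | E]; [| exact E].
rewrite E; symmetry; apply (Hw q q0); trivial.
- rewrite <- E0; exact N0.
- pose proof (isometry_delta f q q0 Hf Hq H0) as D; rewrite E, E0 in D; exact D.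
Qed.

Lemma inv_sqrt2_sqr : 1 / sqrt 2 * (1 / sqrt 2) = 1 / 2.
Proof.
pose proof (sqrt_sqrt 2 ltac:(lra)); pose proof (Rlt_sqrt2_0).
replace (1 / sqrt 2 * (1 / sqrt 2)) with (1 / (sqrt 2 * sqrt 2)) by (field; lra).
rewrite H; reflexivity.
Qed.

Lemma unit_vertices_inH : inH vA /\ inH vB /\ inH vC /\ inH vD.
Proof.
pose proof Rlt_sqrt2_0; pose proof (sqrt_lt_R0 3 ltac:(lra)).
unfold inH; simpl; repeat split; try lra.
apply Rdiv_lt_0_compat; lra.
Qed.

(** Hence the hyperplane through A, B, C, D is the unit hemisphere, whose reflection is the
    inversion q/|q|^2. *)
Lemma unit_vertices_norm : forall q, face_opp_inf q -> qnorm2 q = 1.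
Proof.
pose proof (sqrt_sqrt 3 ltac:(lra)); pose proof inv_sqrt2_sqr.
intros q [-> | [-> | [-> | ->]]]; unfold qnorm2; simpl; nra.
Qed.

Lemma s_inf_reflection : reflection_in face_opp_inf s_inf.
Proof.
split; [exact s_inf_isometry | split].
- intros q Hq; apply unit_vertices_norm in Hq.
  unfold s_inf; rewrite Hq; destruct q; simpl; f_equal; field.
- exists (Q 2 0 0 0); split; [unfold inH; simpl; lra |].
  intros E; apply (f_equal qr) in E; revert E; unfold s_inf, qnorm2; simpl; lra.
Qed.

(** At a vertex P of norm 1 the coordinates [Xn P] and [Xa P] coincide, so the distance from q to P
    depends only on the linear form Xa + Xn - 2<Im P, Xu> at q. The forms of A, B, C, D together
    determine Xa + Xn and all of Xu. *)
Lemma reflection_s_inf (f : quat -> quat) : reflection_in face_opp_inf f -> eqH f s_inf.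
Proof.
intros (Hf & Hfix & Hne); apply reflection_unique; trivial.
- intros q Hq.
  pose proof (isometry_preservesH f Hf q Hq) as Hq'.
  destruct unit_vertices_inH as (HA & HB & HC & HD).
  assert (K : forall P, inH P -> face_opp_inf P ->
     Xa (f q) + Xn (f q) - 2 * (qi P * Xu I1 (f q) + qj P * Xu I2 (f q) + qk P * Xu I3 (f q))
     = Xa q + Xn q - 2 * (qi P * Xu I1 q + qj P * Xu I2 q + qk P * Xu I3 q)).
  { intros P HP FP.
    pose proof (isometry_delta f q P Hf Hq HP) as D; rewrite (Hfix P FP) in D.
    rewrite !delta_X in D by trivial.
    assert (En : Xn P = Xa P)
      by (unfold Xn; rewrite (unit_vertices_norm P FP); unfold Xa, Rdiv; ring).
    assert (Eu : forall i, Xu i P = coord P i * Xa P) by reflexivity.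
    rewrite En, !Eu in D; pose proof (Xa_pos P HP); simpl in D.
    apply (Rmult_eq_reg_r (Xa P)); lra. }
  pose proof (K vA HA ltac:(red; auto)) as KA; pose proof (K vB HB ltac:(red; auto)) as KB.
  pose proof (K vC HC ltac:(red; auto)) as KC; pose proof (K vD HD ltac:(red; auto)) as KD.
  simpl in KA, KB, KC, KD.
  assert (E1 : Xu I1 (f q) = Xu I1 q) by lra.
  assert (E2 : Xu I2 (f q) = Xu I2 q) by lra.
  assert (E3 : Xu I3 (f q) = Xu I3 q) by lra.
  pose proof (X_quadric q Hq) as Z; pose proof (X_quadric _ Hq') as Z'.
  rewrite E1, E2, E3, <- Z in Z'.
  (* The quadric makes the product of [Xa] and [Xn] invariant, and their sum already is; so [f]
     either keeps or exchanges them. *)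
  assert (P : (Xa (f q) - Xa q) * (Xa (f q) - Xn q) = 0).
  { replace (Xn (f q)) with (Xa q + Xn q - Xa (f q)) in Z' by lra; lra. }
  destruct (Rmult_integral _ _ P) as [P' | P']; [left | right].
  + apply X_inj; trivial; [lra | intros []; trivial].
  + apply X_inj; trivial; [apply s_inf_preservesH; trivial | rewrite Xa_s_inf; trivial; lra |].
    intros i; rewrite Xu_s_inf by trivial; destruct i; trivial.
- intros q q0 Hq H0 N D.
  pose proof (s_inf_preservesH q0 H0); pose proof (s_inf_preservesH q Hq).
  rewrite !delta_X, Xa_s_inf, Xn_s_inf, !Xu_s_inf in D by trivial.
  (* The two values of the polar form differ by half this product; one of the points is therefore on
     the mirror [Xa = Xn]. *)
  assert (P : (Xa q - Xn q) * (Xa q0 - Xn q0) = 0) by lra.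
  destruct (Rmult_integral _ _ P) as [P' | P'].
  + apply X_inj; trivial; [rewrite Xa_s_inf; trivial; lra |].
    intros i; rewrite Xu_s_inf; trivial.
  + destruct N; apply X_inj; trivial; [rewrite Xa_s_inf; trivial; lra |].
    intros i; rewrite Xu_s_inf; trivial.
Qed.

(** Adding |Im P|^2 [Xa q] completes the square and gives |q - Im P|^2 / Re q. *)
Definition Xp (P : quat) (q : quat) : R :=
  Xn q - 2 * (qi P * Xu I1 q + qj P * Xu I2 q + qk P * Xu I3 q).

(* Distances to all points of a vertical geodesic: the coefficients of the height
   t and of 1/t are separately invariant. *)
Lemma vline_invariants (f : quat -> quat) (P q : quat) : isometry f ->
  (forall p, vline P p -> f p = p) -> inH q ->
  Xa (f q) = Xa q /\ Xp P (f q) = Xp P q.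
Proof.
intros Hf Hfix Hq; pose proof (isometry_preservesH f Hf q Hq) as Hq'.
assert (K : forall t, 0 < t ->
   Xa (f q) * (t * t + qi P * qi P + qj P * qj P + qk P * qk P) + Xp P (f q)
   = Xa q * (t * t + qi P * qi P + qj P * qj P + qk P * qk P) + Xp P q).
{ intros t Ht.
  set (p := Q t (qi P) (qj P) (qk P)).
  assert (Hp : inH p) by exact Ht.
  pose proof (isometry_delta f q p Hf Hq Hp) as D.
  rewrite (Hfix p) in D by (unfold vline; simpl; auto).
  rewrite !delta_X in D by trivial.
  assert (En : Xn p = (t * t + qi P * qi P + qj P * qj P + qk P * qk P) * Xa p) by reflexivity.
  assert (Eu : forall i, Xu i p = coord p i * Xa p) by reflexivity.
  rewrite En, !Eu in D; pose proof (Xa_pos p Hp); simpl in D.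
  unfold Xp; apply (Rmult_eq_reg_r (Xa p)); lra. }
pose proof (K 1 ltac:(lra)); pose proof (K 2 ltac:(lra)); split; [lra | nra].
Qed.

Lemma vline_euclidean (f : quat -> quat) (P q : quat) : isometry f ->
  (forall p, vline P p -> f p = p) -> inH q ->
  qr (f q) = qr q /\
  (qi (f q) - qi P)^2 + (qj (f q) - qj P)^2 + (qk (f q) - qk P)^2
  = (qi q - qi P)^2 + (qj q - qj P)^2 + (qk q - qk P)^2.
Proof.
intros Hf Hfix Hq; pose proof (isometry_preservesH f Hf q Hq) as Hq'.
destruct (vline_invariants f P q Hf Hfix Hq) as [Ea Ep].
apply Xa_qr in Ea; split; [exact Ea |].
unfold Xp, Xn, Xu in Ep; rewrite Ea in Ep; unfold inH in Hq; simpl in Ep.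
assert (E : qnorm2 (f q) - 2 * (qi P * qi (f q) + qj P * qj (f q) + qk P * qk (f q))
  = qnorm2 q - 2 * (qi P * qi q + qj P * qj q + qk P * qk q)).
{ apply (Rmult_eq_reg_r (/ qr q)); [| apply Rinv_neq_0_compat; lra].
  unfold Rdiv in Ep; lra. }
unfold qnorm2 in E; rewrite Ea in E; lra.
Qed.

Lemma delta_eq_euclidean (q p p' : quat) : inH q -> inH p -> qr p' = qr p ->
  delta q p' = delta q p ->
  (qi q - qi p')^2 + (qj q - qj p')^2 + (qk q - qk p')^2
  = (qi q - qi p)^2 + (qj q - qj p)^2 + (qk q - qk p)^2.
Proof.
unfold inH, delta; intros Hq Hp Hr D; rewrite Hr in D.
assert (E : qdist2 q p' = qdist2 q p).
{ apply (Rmult_eq_reg_r (/ (2 * qr q * qr p))); [exact D | apply Rinv_neq_0_compat; nra]. }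
unfold qdist2 in E; rewrite Hr in E; lra.
Qed.

(** Horizontally, [f] keeps the distances to the feet of three vertical geodesics. Differences of
    the squared distances are linear and leave one unknown; the remaining quadratic equation factors
    into the identity and the reflection. The same scheme serves for [s_B], [s_C] and [s_D]. *)
Lemma reflection_s_A (f : quat -> quat) : reflection_in face_opp_A f -> eqH f s_A.
Proof.
intros (Hf & Hfix & Hne); apply reflection_unique; trivial.
- intros q Hq.
  destruct (vline_euclidean f vB q Hf) as [Er E1]; [intros; apply Hfix; red; auto | auto |].
  destruct (vline_euclidean f vC q Hf) as [_ E2]; [intros; apply Hfix; red; auto | auto |].
  destruct (vline_euclidean f vD q Hf) as [_ E3]; [intros; apply Hfix; red; auto | auto |].
  simpl in E1, E2, E3.
  assert (Ej : qj (f q) = qj q) by lra.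
  assert (Ek : qk (f q) = qk q) by lra.
  rewrite Ej, Ek in E1.
  assert (P : (qi (f q) - qi q) * (qi (f q) - (1 - qi q)) = 0) by lra.
  destruct (Rmult_integral _ _ P); [left | right]; apply quat_ext; simpl; lra.
- intros q q0 Hq H0 N D; apply delta_eq_euclidean in D; trivial; simpl in D.
  assert (P : (2 * qi q - 1) * (2 * qi q0 - 1) = 0) by lra.
  destruct (Rmult_integral _ _ P); [| destruct N]; apply quat_ext; simpl; lra.
Qed.

Lemma reflection_s_B (f : quat -> quat) : reflection_in face_opp_B f -> eqH f s_B.
Proof.
intros (Hf & Hfix & Hne); apply reflection_unique; trivial.
- intros q Hq.
  destruct (vline_euclidean f vA q Hf) as [Er E1]; [intros; apply Hfix; red; auto | auto |].
  destruct (vline_euclidean f vC q Hf) as [_ E2]; [intros; apply Hfix; red; auto | auto |].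
  destruct (vline_euclidean f vD q Hf) as [_ E3]; [intros; apply Hfix; red; auto | auto |].
  simpl in E1, E2, E3.
  assert (Ek : qk (f q) = qk q) by lra.
  rewrite Ek in E1, E2.
  assert (Ej : qj (f q) = qi q + qj q - qi (f q)) by lra.
  rewrite Ej in E1.
  assert (P : (qi (f q) - qi q) * (qi (f q) - qj q) = 0) by lra.
  destruct (Rmult_integral _ _ P); [left | right]; apply quat_ext; simpl; lra.
- intros q q0 Hq H0 N D; apply delta_eq_euclidean in D; trivial; simpl in D.
  assert (P : (qi q - qj q) * (qi q0 - qj q0) = 0) by lra.
  destruct (Rmult_integral _ _ P); [| destruct N]; apply quat_ext; simpl; lra.
Qed.

Lemma reflection_s_C (f : quat -> quat) : reflection_in face_opp_C f -> eqH f s_C.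
Proof.
intros (Hf & Hfix & Hne); apply reflection_unique; trivial.
- intros q Hq.
  destruct (vline_euclidean f vA q Hf) as [Er E1]; [intros; apply Hfix; red; auto | auto |].
  destruct (vline_euclidean f vB q Hf) as [_ E2]; [intros; apply Hfix; red; auto | auto |].
  destruct (vline_euclidean f vD q Hf) as [_ E3]; [intros; apply Hfix; red; auto | auto |].
  simpl in E1, E2, E3.
  assert (Ei : qi (f q) = qi q) by lra.
  rewrite Ei in E1, E2, E3.
  assert (Ek : qk (f q) = qj q + qk q - qj (f q)) by lra.
  rewrite Ek in E1, E2.
  assert (P : (qj (f q) - qj q) * (qj (f q) - qk q) = 0) by lra.
  destruct (Rmult_integral _ _ P); [left | right]; apply quat_ext; simpl; lra.
- intros q q0 Hq H0 N D; apply delta_eq_euclidean in D; trivial; simpl in D.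
  assert (P : (qj q - qk q) * (qj q0 - qk q0) = 0) by lra.
  destruct (Rmult_integral _ _ P); [| destruct N]; apply quat_ext; simpl; lra.
Qed.

Lemma reflection_s_D (f : quat -> quat) : reflection_in face_opp_D f -> eqH f s_D.
Proof.
intros (Hf & Hfix & Hne); apply reflection_unique; trivial.
- intros q Hq.
  destruct (vline_euclidean f vA q Hf) as [Er E1]; [intros; apply Hfix; red; auto | auto |].
  destruct (vline_euclidean f vB q Hf) as [_ E2]; [intros; apply Hfix; red; auto | auto |].
  destruct (vline_euclidean f vC q Hf) as [_ E3]; [intros; apply Hfix; red; auto | auto |].
  simpl in E1, E2, E3.
  assert (Ei : qi (f q) = qi q) by lra.
  assert (Ej : qj (f q) = qj q) by lra.
  rewrite Ei, Ej in E1.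
  assert (P : (qk (f q) - qk q) * (qk (f q) + qk q) = 0) by lra.
  destruct (Rmult_integral _ _ P); [left | right]; apply quat_ext; simpl; lra.
- intros q q0 Hq H0 N D; apply delta_eq_euclidean in D; trivial; simpl in D.
  assert (P : qk q * qk q0 = 0) by lra.
  destruct (Rmult_integral _ _ P); [| destruct N]; apply quat_ext; simpl; lra.
Qed.

Ltac vertical_reflection_in iso :=
  split; [exact iso | split];
  [ intros q Hq; unfold face_opp_A, face_opp_B, face_opp_C, face_opp_D, vline in Hq;
    simpl in Hq; destruct Hq as [Hq | [Hq | Hq]]; destruct Hq as (? & ? & ? & ?);
    apply quat_ext; simpl; lra
  (* A point off all four vertical mirrors: 2, 3, 5 are distinct, 2 is not 1/2 and 5 is not 0. *)
  | exists (Q 1 2 3 5); split; [unfold inH; simpl; lra |];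
    intros E; injection E; intros; lra ].

Lemma s_A_reflection : reflection_in face_opp_A s_A.
Proof. vertical_reflection_in s_A_isometry. Qed.
Lemma s_B_reflection : reflection_in face_opp_B s_B.
Proof. vertical_reflection_in s_B_isometry. Qed.
Lemma s_C_reflection : reflection_in face_opp_C s_C.
Proof. vertical_reflection_in s_C_isometry. Qed.
Lemma s_D_reflection : reflection_in face_opp_D s_D.
Proof. vertical_reflection_in s_D_isometry. Qed.

(** * Generated groups *)

Lemma generated_base (S : (quat -> quat) -> Prop) (s : quat -> quat) : S s -> generated S s.
Proof.
intros Hs; exists (compose s (fun q => q)); split; [| intros q _; reflexivity].
constructor; [exact Hs | constructor].
Qed.

Lemma generated_id (S : (quat -> quat) -> Prop) : generated S (fun q => q).
Proof. exists (fun q => q); split; [constructor | intros q _; reflexivity]. Qed.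

Lemma generated_eqH (S : (quat -> quat) -> Prop) (f g : quat -> quat) :
  eqH f g -> generated S g -> generated S f.
Proof.
intros E (w & Hw & Ew); exists w; split; [exact Hw |].
intros q Hq; rewrite E; auto.
Qed.

Lemma words_preservesH (S : (quat -> quat) -> Prop) (w : quat -> quat) :
  (forall s, S s -> preservesH s) -> words S w -> preservesH w.
Proof.
intros HS Hw; induction Hw as [| s w Hs _ IH]; intros q Hq; [exact Hq |].
apply (HS s Hs), IH, Hq.
Qed.

Lemma words_compose (S : (quat -> quat) -> Prop) (v w : quat -> quat) :
  words S v -> words S w -> exists x, words S x /\ forall q, x q = v (w q).
Proof.
intros Hv Hw; induction Hv as [| s v Hs _ (x & Hx & Ex)].
- exists w; auto.
- exists (compose s x); split; [constructor; trivial |].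
  intros q; unfold compose; rewrite Ex; reflexivity.
Qed.

Lemma generated_compose (S : (quat -> quat) -> Prop) (f g : quat -> quat) :
  (forall s, S s -> preservesH s) ->
  generated S f -> generated S g -> generated S (compose f g).
Proof.
intros HS (v & Hv & Ev) (w & Hw & Ew).
destruct (words_compose S v w Hv Hw) as (x & Hx & Ex).
exists x; split; [exact Hx |].
intros q Hq; unfold compose; rewrite Ex, Ew, Ev; trivial.
apply (words_preservesH S w HS Hw q Hq).
Qed.

Lemma generated_sub (S S' : (quat -> quat) -> Prop) (f : quat -> quat) :
  (forall s, S s -> preservesH s) -> (forall s, S' s -> preservesH s) ->
  (forall s, S s -> generated S' s) -> generated S f -> generated S' f.
Proof.
intros HS HS' Hsub (w & Hw & Ew); apply (generated_eqH S' f w Ew); clear f Ew.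
induction Hw as [| s w Hs _ IH]; [apply generated_id |].
apply generated_compose; auto.
Qed.

Definition mirrors (f : quat -> quat) : Prop :=
  f = s_inf \/ f = s_A \/ f = s_B \/ f = s_C \/ f = s_D.

Lemma mirrors_isometry (f : quat -> quat) : mirrors f -> isometry f.
Proof.
intros [-> | [-> | [-> | [-> | ->]]]];
  auto using s_inf_isometry, s_A_isometry, s_B_isometry, s_C_isometry, s_D_isometry.
Qed.

Lemma mirrors_preservesH (f : quat -> quat) : mirrors f -> preservesH f.
Proof. auto using isometry_preservesH, mirrors_isometry. Qed.

Lemma gens_Gamma_isometry (f : quat -> quat) : gens_Gamma f -> isometry f.
Proof. intros [H | [H | [H | [H | H]]]]; apply H. Qed.

(** [gens_Gamma] admits every map that agrees on the half-space with a reflection, whatever it does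
    elsewhere. Words in it can be replaced by words in five explicit maps because [generated] only
    compares up to [eqH]. *)
Lemma Gamma_mirrors (f : quat -> quat) : Gamma3434 f <-> generated mirrors f.
Proof.
split; apply generated_sub;
  auto using mirrors_preservesH, isometry_preservesH, gens_Gamma_isometry; intros s.
- intros [H | [H | [H | [H | H]]]];
    [apply reflection_s_inf in H | apply reflection_s_A in H | apply reflection_s_B in H
    | apply reflection_s_C in H | apply reflection_s_D in H];
    eapply generated_eqH; try exact H; apply generated_base; red; auto.
- intros [-> | [-> | [-> | [-> | ->]]]]; apply generated_base; red;
    auto 6 using s_inf_reflection, s_A_reflection, s_B_reflection, s_C_reflection, s_D_reflection.
Qed.

Lemma Gamma_isometry (f : quat -> quat) : Gamma3434 f -> isometry f.
Proof.
intros (w & Hw & Ew); apply (isometry_eqH f w Ew); clear f Ew.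
induction Hw as [| s w Hs _ IH]; [exact isometry_id |].
apply isometry_compose; auto using gens_Gamma_isometry.
Qed.

Lemma Gamma_compose (f g : quat -> quat) :
  Gamma3434 f -> Gamma3434 g -> Gamma3434 (compose f g).
Proof.
apply generated_compose; auto using isometry_preservesH, gens_Gamma_isometry.
Qed.

(** * Discreteness *)

Definition isZ (x : R) : Prop := exists z : Z, x = IZR z.

Lemma isZ_IZR (z : Z) : isZ (IZR z).
Proof. exists z; reflexivity. Qed.

Lemma isZ_add (x y : R) : isZ x -> isZ y -> isZ (x + y).
Proof. intros [a ->] [b ->]; exists (a + b)%Z; rewrite plus_IZR; reflexivity. Qed.

Lemma isZ_mul (x y : R) : isZ x -> isZ y -> isZ (x * y).
Proof. intros [a ->] [b ->]; exists (a * b)%Z; rewrite mult_IZR; reflexivity. Qed.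

Lemma isZ_opp (x : R) : isZ x -> isZ (- x).
Proof. intros [a ->]; exists (- a)%Z; rewrite opp_IZR; reflexivity. Qed.

Lemma isZ_sub (x y : R) : isZ x -> isZ y -> isZ (x - y).
Proof. intros; apply isZ_add; auto using isZ_opp. Qed.

Lemma Xn_s_A (q : quat) : inH q -> Xn (s_A q) = Xn q - 2 * Xu I1 q + Xa q.
Proof. unfold inH, Xn, Xa, Xu, qnorm2; simpl; intros; field; lra. Qed.

Lemma Xu_s_A (q : quat) (i : axis) : inH q ->
  Xu i (s_A q) = match i with I1 => Xa q - Xu I1 q | _ => Xu i q end.
Proof. unfold inH, Xu, Xa; destruct i; simpl; intros; field; lra. Qed.

Definition integral_point (q : quat) : Prop :=
  isZ (Xa q) /\ isZ (Xn q) /\ forall i, isZ (Xu i q).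

Lemma mirrors_integral (s : quat -> quat) (q : quat) :
  mirrors s -> inH q -> integral_point q -> integral_point (s q).
Proof.
intros Hs Hq (Ha & Hn & Hu).
destruct Hs as [-> | [-> | [-> | [-> | ->]]]]; repeat split.
- rewrite Xa_s_inf; auto.
- rewrite Xn_s_inf; auto.
- intros i; rewrite Xu_s_inf; auto.
- exact Ha.
- rewrite Xn_s_A by trivial.
  apply isZ_add; [apply isZ_sub; [| apply isZ_mul; [apply isZ_IZR |]] |]; auto.
- intros i; rewrite Xu_s_A by trivial; destruct i; auto using isZ_sub.
- exact Ha.
- replace (Xn (s_B q)) with (Xn q) by (unfold Xn, qnorm2; simpl; f_equal; ring); exact Hn.
- intros []; [exact (Hu I2) | exact (Hu I1) | exact (Hu I3)].
- exact Ha.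
- replace (Xn (s_C q)) with (Xn q) by (unfold Xn, qnorm2; simpl; f_equal; ring); exact Hn.
- intros []; [exact (Hu I1) | exact (Hu I3) | exact (Hu I2)].
- exact Ha.
- replace (Xn (s_D q)) with (Xn q) by (unfold Xn, qnorm2; simpl; f_equal; ring); exact Hn.
- intros []; [exact (Hu I1) | exact (Hu I2) |].
  replace (Xu I3 (s_D q)) with (- Xu I3 q) by (unfold Xu; simpl; unfold Rdiv; ring).
  apply isZ_opp, Hu.
Qed.

Lemma Gamma_integral (g : quat -> quat) (q : quat) :
  Gamma3434 g -> inH q -> integral_point q -> integral_point (g q).
Proof.
rewrite Gamma_mirrors; intros (w & Hw & Ew) Hq Zq; rewrite Ew by trivial; clear g Ew.
assert (H : inH (w q) /\ integral_point (w q)); [| apply H].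
induction Hw as [| s w Hs _ IH]; [auto |].
destruct IH as [IH1 IH2]; unfold compose; split.
- apply mirrors_preservesH; trivial.
- apply mirrors_integral; trivial.
Qed.

(* For integral points p, q the number 2 delta p q is an integer. *)
Lemma integral_close_eq (p q : quat) : inH p -> inH q ->
  integral_point p -> integral_point q -> delta p q < 1 / 2 -> p = q.
Proof.
intros Hp Hq (Pa & Pn & Pu) (Qa & Qn & Qu) Hd.
assert (HZ : isZ (2 * delta p q)).
{ rewrite delta_X by trivial.
  replace (2 * _) with (Xa p * Xn q + Xn p * Xa q -
    2 * (Xu I1 p * Xu I1 q + Xu I2 p * Xu I2 q + Xu I3 p * Xu I3 q + 1)) by field.
  pose proof (isZ_IZR 1); pose proof (isZ_IZR 2).
  auto 12 using isZ_sub, isZ_add, isZ_mul. }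
pose proof (delta_nonneg p q Hp Hq); destruct HZ as [z Hz].
assert (z = 0%Z).
{ assert (-1 < z < 1)%Z; [split; apply lt_IZR; lra | lia]. }
subst z; apply delta_eq_0; trivial; lra.
Qed.

(** Integral points whose X-vectors span R^5 ([orient_frame] finds their determinant nonzero), each
    at [delta] 0 or 1/2 from the first one. *)
Definition frame_point (q : quat) : Prop :=
  q = Q 1 0 0 0 \/ q = Q 1 1 0 0 \/ q = Q 1 0 1 0 \/ q = Q 1 0 0 1 \/ q = Q (1/2) (1/2) 0 0.

Ltac frame_compute := unfold Xa, Xn, Xu, qnorm2; simpl; field.

Lemma frame_integral (q : quat) : frame_point q -> inH q /\ integral_point q.
Proof.
intros Hq; split; [| repeat split].
- destruct Hq as [-> | [-> | [-> | [-> | ->]]]]; unfold inH; simpl; lra.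
- destruct Hq as [-> | [-> | [-> | [-> | ->]]]];
    [exists 1%Z | exists 1%Z | exists 1%Z | exists 1%Z | exists 2%Z]; frame_compute.
- destruct Hq as [-> | [-> | [-> | [-> | ->]]]];
    [exists 1%Z | exists 2%Z | exists 2%Z | exists 2%Z | exists 1%Z]; frame_compute.
- intros []; destruct Hq as [-> | [-> | [-> | [-> | ->]]]];
    ((exists 0%Z; frame_compute; fail) || (exists 1%Z; frame_compute)).
Qed.

(** The polar form is nondegenerate, so the values of [delta] at five spanning points determine the
    X-coordinates of a point. *)
Lemma frame_rigid (g : quat -> quat) : isometry g ->
  (forall p, frame_point p -> g p = p) -> eqH g (fun q => q).
Proof.
intros Hg Hfix q Hq; pose proof (isometry_preservesH g Hg q Hq) as Hq'.
assert (K : forall p, frame_point p -> delta (g q) p = delta q p).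
{ intros p Fp; rewrite <- (Hfix p Fp) at 1.
  apply isometry_delta; trivial; apply frame_integral, Fp. }
assert (E : forall p, frame_point p ->
  (Xa (g q) * Xn p + Xn (g q) * Xa p) / 2 - Xu I1 (g q) * Xu I1 p
              - Xu I2 (g q) * Xu I2 p - Xu I3 (g q) * Xu I3 p
  = (Xa q * Xn p + Xn q * Xa p) / 2 - Xu I1 q * Xu I1 p
              - Xu I2 q * Xu I2 p - Xu I3 q * Xu I3 p).
{ intros p Fp; specialize (K p Fp).
  rewrite !delta_X in K; trivial; try (apply frame_integral, Fp); lra. }
pose proof (E (Q 1 0 0 0) ltac:(red; auto)) as E0.
pose proof (E (Q 1 1 0 0) ltac:(red; auto)) as E1.
pose proof (E (Q 1 0 1 0) ltac:(red; auto)) as E2.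
pose proof (E (Q 1 0 0 1) ltac:(red; auto)) as E3.
pose proof (E (Q (1/2) (1/2) 0 0) ltac:(red; auto 6)) as E4.
(* The occurrence numbers pick the evaluations at the frame point; the coordinates of [q] and [g q]
   stay folded as unknowns of a linear system. *)
unfold Xa at 2 4, Xn at 1 3, Xu at 2 4 6 8 10 12, qnorm2 in E0; simpl in E0.
unfold Xa at 2 4, Xn at 1 3, Xu at 2 4 6 8 10 12, qnorm2 in E1; simpl in E1.
unfold Xa at 2 4, Xn at 1 3, Xu at 2 4 6 8 10 12, qnorm2 in E2; simpl in E2.
unfold Xa at 2 4, Xn at 1 3, Xu at 2 4 6 8 10 12, qnorm2 in E3; simpl in E3.
unfold Xa at 2 4, Xn at 1 3, Xu at 2 4 6 8 10 12, qnorm2 in E4; simpl in E4.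
apply X_inj; trivial; [lra | intros []; lra].
Qed.

(** The constant [arcosh1 (1/2)] plays two parts: as radius it is the distance from the first frame
    point to the other four, as epsilon it is the threshold of [integral_close_eq]. *)
Lemma Gamma_discrete : discrete_group Gamma3434.
Proof.
assert (H0 : 0 < arcosh1 (1/2)).
{ replace 0 with (arcosh1 0); [apply arcosh1_lt; lra |].
  unfold arcosh1; rewrite Rmult_0_l, sqrt_0, !Rplus_0_r; apply ln_1. }
exists (Q 1 0 0 0), (arcosh1 (1/2)), (arcosh1 (1/2)).
split; [unfold inH; simpl; lra |]; do 2 (split; [exact H0 |]).
intros g Gg Hball; pose proof (Gamma_isometry g Gg) as Ig.
apply frame_rigid; trivial; intros p Fp.
destruct (frame_integral p Fp) as [Hp Zp].
pose proof (isometry_preservesH g Ig p Hp) as Hp'.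
apply integral_close_eq; trivial; [apply Gamma_integral; trivial |].
assert (Hd : hdist p (Q 1 0 0 0) <= arcosh1 (1/2)).
{ rewrite hdist_delta.
  assert (D : delta p (Q 1 0 0 0) = 0 \/ delta p (Q 1 0 0 0) = 1 / 2).
  { destruct Fp as [-> | [-> | [-> | [-> | ->]]]]; unfold delta, qdist2; simpl; lra. }
  destruct D as [-> | ->]; [| lra]; apply Rlt_le, arcosh1_lt; lra. }
specialize (Hball p Hp Hd); rewrite hdist_delta in Hball.
apply Rnot_le_lt; intros [L | L].
- apply arcosh1_lt in L; lra.
- rewrite <- L in Hball; lra.
Qed.

(** * Signed permutations *)

Definition sg (b : bool) : R := if b then -1 else 1.

Lemma sg_xorb (b c : bool) : sg (xorb b c) = sg b * sg c.
Proof. destruct b, c; simpl; ring. Qed.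

Lemma sg_sqr (b : bool) : sg b * sg b = 1.
Proof. destruct b; simpl; ring. Qed.

Definition sp (p : axis -> axis) (b : axis -> bool) (q : quat) : quat :=
  Q (qr q) (sg (b I1) * coord q (p I1)) (sg (b I2) * coord q (p I2))
    (sg (b I3) * coord q (p I3)).

Lemma coord_sp (p : axis -> axis) (b : axis -> bool) (q : quat) (i : axis) :
  coord (sp p b q) i = sg (b i) * coord q (p i).
Proof. destruct i; reflexivity. Qed.

Lemma sp_ext (p p' : axis -> axis) (b b' : axis -> bool) (q : quat) :
  (forall i, p i = p' i) -> (forall i, b i = b' i) -> sp p b q = sp p' b' q.
Proof. intros Hp Hb; unfold sp; rewrite !Hp, !Hb; reflexivity. Qed.

Lemma sp_comp (p p' : axis -> axis) (b b' : axis -> bool) (q : quat) :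
  sp p b (sp p' b' q) = sp (fun i => p' (p i)) (fun i => xorb (b i) (b' (p i))) q.
Proof.
apply coord_ext; [reflexivity |].
intros i; rewrite !coord_sp, sg_xorb; ring.
Qed.

Lemma sp_id (q : quat) : sp (fun i => i) (fun _ => false) q = q.
Proof. apply coord_ext; [reflexivity | intros i; rewrite coord_sp; simpl; ring]. Qed.

Definition perm (p : axis -> axis) : Prop := forall i j, p i = p j -> i = j.

Lemma sp_preservesH (p : axis -> axis) (b : axis -> bool) : preservesH (sp p b).
Proof. intros q Hq; exact Hq. Qed.

Ltac perm_cases p Hp :=
  destruct (p I1) eqn:P1; destruct (p I2) eqn:P2; destruct (p I3) eqn:P3;
  try (exfalso; assert (I1 = I2) by (apply Hp; congruence); discriminate);
  try (exfalso; assert (I1 = I3) by (apply Hp; congruence); discriminate);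
  try (exfalso; assert (I2 = I3) by (apply Hp; congruence); discriminate).

Lemma Gamma_eqH (f g : quat -> quat) : eqH f g -> Gamma3434 g -> Gamma3434 f.
Proof. apply generated_eqH. Qed.

Lemma Gamma_mirror (s : quat -> quat) : mirrors s -> Gamma3434 s.
Proof. intros Hs; apply Gamma_mirrors, generated_base, Hs. Qed.

Lemma Gamma_s_B : Gamma3434 s_B.
Proof. apply Gamma_mirror; red; auto. Qed.
Lemma Gamma_s_C : Gamma3434 s_C.
Proof. apply Gamma_mirror; red; auto. Qed.
Lemma Gamma_s_D : Gamma3434 s_D.
Proof. apply Gamma_mirror; red; auto 6. Qed.

(** The single sign changes are [s_D], its conjugate by [s_C], and the conjugate of that by
    [s_B]. *)
Lemma Gamma_signs (b : axis -> bool) : Gamma3434 (sp (fun i => i) b).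
Proof.
pose proof Gamma_s_D as G3.
pose proof (Gamma_compose _ _ Gamma_s_C (Gamma_compose _ _ G3 Gamma_s_C)) as G2.
pose proof (Gamma_compose _ _ Gamma_s_B (Gamma_compose _ _ G2 Gamma_s_B)) as G1.
pose (pow := fun (c : bool) (f : quat -> quat) q => if c then f q else q).
assert (Gpow : forall c f, Gamma3434 f -> Gamma3434 (pow c f)).
{ intros [] f Gf; [exact Gf | apply generated_id]. }
eapply Gamma_eqH;
  [| exact (Gamma_compose _ _ (Gpow (b I1) _ G1)
       (Gamma_compose _ _ (Gpow (b I2) _ G2) (Gpow (b I3) _ G3)))].
intros q _; unfold compose, pow, sp.
destruct (b I1), (b I2), (b I3); apply quat_ext; simpl; ring.
Qed.

Lemma Gamma_sp (p : axis -> axis) (b : axis -> bool) : perm p -> Gamma3434 (sp p b).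
Proof.
intros Hp; apply (Gamma_eqH _ (compose (sp (fun i => i) b) (sp p (fun _ => false)))).
{ intros q _; unfold compose; rewrite sp_comp; apply sp_ext; [reflexivity |].
  intros i; rewrite xorb_false_r; reflexivity. }
apply Gamma_compose; [apply Gamma_signs |].
pose proof (generated_id gens_Gamma) as G1.
pose proof Gamma_s_B as G2; pose proof Gamma_s_C as G3.
pose proof (Gamma_compose _ _ G2 G3) as G4; pose proof (Gamma_compose _ _ G3 G2) as G5.
pose proof (Gamma_compose _ _ G2 G5) as G6.
perm_cases p Hp;
 let solve_with G := (eapply Gamma_eqH; [| exact G]; intros q _; unfold compose, sp;
   rewrite P1, P2, P3; apply quat_ext; simpl; ring) in
 first [solve_with G1 | solve_with G2 | solve_with G3 | solve_with G4 | solve_with G5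
   | solve_with G6].
Qed.

(** * Integral translations in Gamma *)

Definition imag (x y z : R) : quat := Q 0 x y z.

Lemma Gamma_tau_add (v w : quat) :
  Gamma3434 (tau v) -> Gamma3434 (tau w) -> Gamma3434 (tau (qadd v w)).
Proof.
intros Gv Gw; apply (Gamma_eqH _ (compose (tau v) (tau w))); [| apply Gamma_compose; trivial].
intros q _; apply quat_ext; simpl; ring.
Qed.

Lemma Gamma_tau_I1_nat (n : nat) : Gamma3434 (tau (imag (INR n) 0 0)).
Proof.
induction n as [| n IH].
- apply (Gamma_eqH _ (fun q => q)); [| apply generated_id].
  intros q _; apply quat_ext; simpl; ring.
- rewrite S_INR.
  replace (imag (INR n + 1) 0 0) with (qadd (imag (INR n) 0 0) (imag 1 0 0))
    by (apply quat_ext; simpl; ring).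
  apply Gamma_tau_add; trivial.
  (* The unit translation is the product of the reflections in the parallel mirrors x = 0 and x =
     1/2. *)
  apply (Gamma_eqH _ (compose s_A (sp (fun i => i)
    (fun i => match i with I1 => true | _ => false end)))).
  + intros q _; apply quat_ext; simpl; ring.
  + apply Gamma_compose; [apply Gamma_mirror; red; auto | apply Gamma_signs].
Qed.

Lemma Gamma_tau_I1 (z : Z) : Gamma3434 (tau (imag (IZR z) 0 0)).
Proof.
destruct (Z_le_gt_dec 0 z) as [Hz | Hz].
- rewrite <- (Z2Nat.id z), <- INR_IZR_INZ by trivial; apply Gamma_tau_I1_nat.
- pose (f := sp (fun i => i) (fun _ => true)).
  apply (Gamma_eqH _ (compose f (compose (tau (imag (INR (Z.to_nat (- z))) 0 0)) f))).
  + intros q _; rewrite INR_IZR_INZ, Z2Nat.id, opp_IZR by lia.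
    apply quat_ext; simpl; ring.
  + pose proof (Gamma_signs (fun _ => true)).
    auto using Gamma_compose, Gamma_tau_I1_nat.
Qed.

Lemma Gamma_tau (w : quat) : lipschitz_imag w -> Gamma3434 (tau w).
Proof.
intros (Hr & b & c & d & Hb & Hc & Hd).
assert (G1 := Gamma_tau_I1 b).
assert (G2 : Gamma3434 (tau (imag 0 (IZR c) 0))).
{ apply (Gamma_eqH _ (compose s_B (compose (tau (imag (IZR c) 0 0)) s_B))).
  - intros q _; apply quat_ext; simpl; ring.
  - auto using Gamma_compose, Gamma_tau_I1, Gamma_s_B. }
assert (G3 : Gamma3434 (tau (imag 0 0 (IZR d)))).
{ apply (Gamma_eqH _ (compose s_C (compose (compose s_B (compose (tau (imag (IZR d) 0 0)) s_B))
     s_C))).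
  - intros q _; apply quat_ext; simpl; ring.
  - auto 6 using Gamma_compose, Gamma_tau_I1, Gamma_s_B, Gamma_s_C. }
replace w with (qadd (imag (IZR b) 0 0) (qadd (imag 0 (IZR c) 0) (imag 0 0 (IZR d)))).
- auto using Gamma_tau_add.
- apply quat_ext; simpl; lra.
Qed.

(** * Finite covolume *)

(** Over the cube |x_i| <= 1/2 a point below height 1/2 has norm less than 1, so inversion raises
    it; stopping at the smaller height 1/4 makes the gain uniform. The base is wider than that cube
    so that the region can be open and still contain it. *)
Definition cusp_region (q : quat) : Prop :=
  1 / 4 < qr q /\ -1 < qi q < 1 /\ -1 < qj q < 1 /\ -1 < qk q < 1.

Definition covered (y : quat) : Prop :=
  exists g x, Gamma3434 g /\ cusp_region x /\ g x = y.

Lemma covered_step (s : quat -> quat) (x : quat) :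
  Gamma3434 s -> covered x -> covered (s x).
Proof.
intros Gs (g & u & Gg & Hu & <-); exists (compose s g), u; repeat split; try apply Hu.
apply Gamma_compose; trivial.
Qed.

Lemma round_half (x : R) : exists z : Z, - (1 / 2) <= x - IZR z <= 1 / 2.
Proof.
exists (up (x - 1 / 2)); destruct (archimed (x - 1 / 2)); lra.
Qed.

Lemma translate_half (y : quat) : exists w, lipschitz_imag w /\ exists y', tau w y' = y /\
  qr y' = qr y /\ forall i, - (1 / 2) <= coord y' i <= 1 / 2.
Proof.
destruct (round_half (qi y)) as [b Hb], (round_half (qj y)) as [c Hc],
  (round_half (qk y)) as [d Hd].
exists (imag (IZR b) (IZR c) (IZR d)); split; [split; [reflexivity | exists b, c, d; auto] |].
exists (Q (qr y) (qi y - IZR b) (qj y - IZR c) (qk y - IZR d)); repeat split.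
- apply quat_ext; simpl; ring.
- destruct i; simpl; lra.
- destruct i; simpl; lra.
Qed.

(* Over the cube |x_i| <= 1/2, a point of height at most 1/4 has norm squared at most
   13/16, so that the inversion raises it by a factor at least 16/13. *)
Lemma covered_descent (n : nat) (y : quat) :
  inH y -> 1 / 4 < qr y * (16 / 13) ^ n -> covered y.
Proof.
revert y; induction n as [| n IH]; intros y Hy Hn;
  destruct (translate_half y) as (w & Hw & y' & <- & Hr & Hc);
  assert (Hy' : inH y') by (unfold inH in *; rewrite Hr; exact Hy);
  apply covered_step; auto using Gamma_tau;
  pose proof (Hc I1) as H1; pose proof (Hc I2) as H2; pose proof (Hc I3) as H3;
  simpl in H1, H2, H3; rewrite <- Hr in Hn.
- exists (fun q => q), y'; split; [apply generated_id | split; [| reflexivity]].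
  simpl in Hn; red; lra.
- destruct (Rlt_or_le (1 / 4) (qr y')) as [L | L].
  + exists (fun q => q), y'; split; [apply generated_id | split; [| reflexivity]].
    red; lra.
  + rewrite <- (s_inf_involutive y') by trivial; apply covered_step.
    * apply Gamma_mirror; red; auto.
    * apply IH; [apply s_inf_preservesH; trivial |].
      pose proof (qnorm2_pos y' Hy') as N; unfold inH in Hy'.
      assert (N' : qnorm2 y' <= 13 / 16) by (unfold qnorm2; nra).
      assert (B : qr y' * (16 / 13) <= qr (s_inf y')).
      { simpl; unfold Rdiv at 2; apply Rmult_le_compat_l; [lra |].
        replace (16 / 13) with (/ (13 / 16)) by field; apply Rinv_le_contravar; lra. }
      assert (P : 0 < (16 / 13) ^ n) by (apply pow_lt; lra).
      simpl in Hn; nra.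
Qed.

Lemma cusp_region_covers (y : quat) : inH y -> covered y.
Proof.
intros Hy; pose proof Hy as Hy'; unfold inH in Hy'.
destruct (INR_unbounded (2 / qr y)) as [n Hn].
apply (covered_descent n); trivial.
(* Bernoulli's inequality: with n > 2 / Re y the height after n gains of 16/13 exceeds 2 * 3/13,
   which is more than 1/4. *)
pose proof (poly n (3 / 13) ltac:(lra)) as B.
replace (1 + 3 / 13) with (16 / 13) in B by field.
assert (2 < INR n * qr y).
{ apply (Rmult_lt_compat_r (qr y)) in Hn; [| trivial].
  replace (2 / qr y * qr y) with 2 in Hn by (field; lra); lra. }
assert (qr y * (1 + INR n * (3 / 13)) <= qr y * (16 / 13) ^ n)
  by (apply Rmult_le_compat_l; lra).
lra.
Qed.

Lemma cusp_region_open : Defs.open_set cusp_region.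
Proof.
intros x (H0 & H1 & H2 & H3).
assert (A : forall a b, 0 < a -> 0 < b -> exists m, 0 < m <= a /\ m <= b).
{ intros a b Ha Hb; exists (Rmin a b); auto using Rmin_glb_lt, Rmin_l, Rmin_r. }
destruct (A (1 - qi x) (qi x + 1)) as (m1 & M1 & M1'); try lra.
destruct (A (1 - qj x) (qj x + 1)) as (m2 & M2 & M2'); try lra.
destruct (A (1 - qk x) (qk x + 1)) as (m3 & M3 & M3'); try lra.
destruct (A m1 m2) as (m4 & M4 & M4'); try lra.
destruct (A m3 m4) as (m5 & M5 & M5'); try lra.
destruct (A (qr x - 1 / 4) m5) as (m & M & M'); try lra.
(* [m] is at most the distance from x to each wall, and is squared because [qdist2] is a squared
   distance. *)
exists (m * m); split; [nra |].
intros y Hy; unfold qdist2 in Hy.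
pose proof (pow2_ge_0 (qr y - qr x)); pose proof (pow2_ge_0 (qi y - qi x)).
pose proof (pow2_ge_0 (qj y - qj x)); pose proof (pow2_ge_0 (qk y - qk x)).
assert (C : forall t, t ^ 2 < m * m -> - m < t < m) by (intros t Ht; nra).
pose proof (C (qr y - qr x) ltac:(lra)); pose proof (C (qi y - qi x) ltac:(lra)).
pose proof (C (qj y - qj x) ltac:(lra)); pose proof (C (qk y - qk x) ltac:(lra)).
red; lra.
Qed.

(** * Volume of the cusp region by iterated one-dimensional integrals *)

Definition sum_over (bs : list box) (f : box -> R) : R := fold_right Rplus 0 (map f bs).

Lemma sum_over_ext (bs : list box) (f g : box -> R) :
  (forall b, In b bs -> f b = g b) -> sum_over bs f = sum_over bs g.
Proof.
intros E; unfold sum_over; f_equal; apply map_ext_in, E.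
Qed.

Definition ind (lo hi x : R) : R :=
  if Rle_dec lo x then if Rle_dec x hi then 1 else 0 else 0.

Lemma interval_dec (lo hi x : R) : lo <= x <= hi \/ ~ (lo <= x <= hi).
Proof. destruct (Rle_dec lo x), (Rle_dec x hi); tauto. Qed.

Lemma ind_in (lo hi x : R) : lo <= x <= hi -> ind lo hi x = 1.
Proof. intros [? ?]; unfold ind; destruct (Rle_dec lo x), (Rle_dec x hi); lra. Qed.

Lemma ind_out (lo hi x : R) : ~ (lo <= x <= hi) -> ind lo hi x = 0.
Proof. intros ?; unfold ind; destruct (Rle_dec lo x), (Rle_dec x hi); tauto || lra. Qed.

Lemma is_RInt_cst (a b c v : R) : v = (b - a) * c -> is_RInt (fun _ => c) a b v.
Proof. intros ->; apply (is_RInt_const a b c). Qed.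

Section Slicing.

Variables (F w : R -> R) (L H : R).
Hypothesis w_nonneg : forall x, L <= x <= H -> 0 <= w x.
Hypothesis w_int : forall a b, L <= a -> a <= b -> b <= H -> is_RInt w a b (F b - F a).

Lemma is_RInt_ind (lo hi c : R) : L <= lo -> lo <= hi -> hi <= H ->
  is_RInt (fun x => c * ind lo hi x * w x) L H (c * (F hi - F lo)).
Proof.
intros H1 H2 H3.
replace (c * (F hi - F lo)) with (plus (plus 0 (c * (F hi - F lo))) 0)
  by (unfold plus; simpl; ring).
assert (Z : forall a b, a <= b -> (b <= lo \/ hi <= a) ->
  is_RInt (fun x => c * ind lo hi x * w x) a b 0).
{ intros a b Hab Hout; apply (is_RInt_ext (fun _ => 0)).
  - rewrite Rmin_left, Rmax_right by trivial; intros x Hx; rewrite ind_out; lra.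
  - apply is_RInt_cst; ring. }
apply (is_RInt_Chasles (V := R_NormedModule)) with (b := hi);
  [apply (is_RInt_Chasles (V := R_NormedModule)) with (b := lo) |].
- apply Z; lra.
- apply (is_RInt_ext (fun x => scal c (w x))).
  + rewrite Rmin_left, Rmax_right by trivial; intros x Hx; rewrite ind_in by lra.
    unfold scal; simpl; unfold mult; simpl; ring.
  + apply (is_RInt_scal w lo hi c (F hi - F lo)); apply w_int; lra.
- apply Z; lra.
Qed.

(** One step of Fubini for step functions. Integration against the density [w] with primitive [F]
    turns the indicator of each interval into F(hi) - F(lo). The coefficient [c b] carries the side
    lengths already integrated and the indicators of the coordinates still to come. *)
Lemma slice_sum_le (bs : list box) (lo hi c : box -> R) (V : R) : L <= H ->
  (forall b, In b bs -> L <= lo b /\ lo b <= hi b /\ hi b <= H) ->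
  (forall x, L <= x <= H -> sum_over bs (fun b => c b * ind (lo b) (hi b) x) <= V) ->
  sum_over bs (fun b => c b * (F (hi b) - F (lo b))) <= V * (F H - F L).
Proof.
intros HLH Hb HV.
apply (is_RInt_le
  (fun x => sum_over bs (fun b => c b * ind (lo b) (hi b) x) * w x)
  (fun x => V * w x) L H); trivial.
- clear HV; induction bs as [| b bs IH].
  + apply (is_RInt_ext (fun _ => 0)); [intros; unfold sum_over; simpl; ring |].
    apply is_RInt_cst; unfold sum_over; simpl; ring.
  + apply (is_RInt_ext (fun x => plus (c b * ind (lo b) (hi b) x * w x)
      (sum_over bs (fun b => c b * ind (lo b) (hi b) x) * w x))).
    * intros x _; unfold sum_over, plus; simpl; ring.
    * apply (is_RInt_plus (V := R_NormedModule)).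
      -- destruct (Hb b (or_introl eq_refl)) as (? & ? & ?); apply is_RInt_ind; trivial.
      -- apply IH; intros b' Hb'; apply Hb; right; exact Hb'.
- apply (is_RInt_scal w L H V (F H - F L)); apply w_int; lra.
- intros x Hx; apply Rmult_le_compat_r; [apply w_nonneg; lra | apply HV; lra].
Qed.

End Slicing.

Definition in_box_ind (b : box) (q : quat) : R :=
  ind (lo0 b) (hi0 b) (qr q) * ind (lo1 b) (hi1 b) (qi q) *
  ind (lo2 b) (hi2 b) (qj q) * ind (lo3 b) (hi3 b) (qk q).

Lemma in_box_ind_in (b : box) (q : quat) : in_box b q -> in_box_ind b q = 1.
Proof.
intros (H0 & H1 & H2 & H3); unfold in_box_ind; rewrite !ind_in by trivial; ring.
Qed.

Lemma in_box_ind_out (b : box) (q : quat) : ~ in_box b q -> in_box_ind b q = 0.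
Proof.
intros H; unfold in_box_ind.
destruct (interval_dec (lo0 b) (hi0 b) (qr q)) as [H0 | H0]; [| rewrite (ind_out _ _ _ H0); ring].
destruct (interval_dec (lo1 b) (hi1 b) (qi q)) as [H1 | H1]; [| rewrite (ind_out _ _ _ H1); ring].
destruct (interval_dec (lo2 b) (hi2 b) (qj q)) as [H2 | H2]; [| rewrite (ind_out _ _ _ H2); ring].
destruct (interval_dec (lo3 b) (hi3 b) (qk q)) as [H3 | H3]; [| rewrite (ind_out _ _ _ H3); ring].
destruct H; red; auto.
Qed.

Definition disjoint_boxes (bs : list box) : Prop :=
  forall i j, (i < length bs)%nat -> (j < length bs)%nat -> i <> j ->
    forall q, ~ (in_box (nth i bs (Box 1 1 0 0 0 0 0 0)) q /\
                 in_box (nth j bs (Box 1 1 0 0 0 0 0 0)) q).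

Lemma in_box_dec (b : box) (q : quat) : in_box b q \/ ~ in_box b q.
Proof.
unfold in_box.
destruct (interval_dec (lo0 b) (hi0 b) (qr q)), (interval_dec (lo1 b) (hi1 b) (qi q)),
  (interval_dec (lo2 b) (hi2 b) (qj q)), (interval_dec (lo3 b) (hi3 b) (qk q)); tauto.
Qed.

Lemma disjoint_multiplicity (bs : list box) (q : quat) :
  disjoint_boxes bs -> sum_over bs (fun b => in_box_ind b q) <= 1.
Proof.
induction bs as [| b bs IH]; intros Hd; [unfold sum_over; simpl; lra |].
change (sum_over (b :: bs) _) with (in_box_ind b q + sum_over bs (fun b => in_box_ind b q)).
destruct (in_box_dec b q) as [Hq | Hq].
- rewrite in_box_ind_in by trivial.
  replace (sum_over bs _) with 0; [lra |].
  symmetry; transitivity (sum_over bs (fun _ => 0)).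
  + apply sum_over_ext; intros b' Hb'; apply in_box_ind_out; intros Hq'.
    destruct (In_nth bs b' (Box 1 1 0 0 0 0 0 0) Hb') as (j & Hj & E).
    apply (Hd 0%nat (S j) ltac:(simpl; lia) ltac:(simpl; lia) ltac:(lia) q).
    simpl; rewrite E; auto.
  + clear; unfold sum_over; induction bs as [| b bs IH]; simpl; lra.
- rewrite in_box_ind_out by trivial; rewrite Rplus_0_l; apply IH.
  intros i j Hi Hj Hij q'.
  apply (Hd (S i) (S j)); simpl; lia.
Qed.

Lemma cusp_weight_int (a b : R) : 1 / 4 <= a -> a <= b ->
  is_RInt (fun x => / x ^ 4) a b (- / (3 * b ^ 3) - - / (3 * a ^ 3)).
Proof.
intros Ha Hab; apply (is_RInt_derive (fun x => - / (3 * x ^ 3))).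
- rewrite Rmin_left, Rmax_right by trivial; intros x Hx.
  auto_derive; [nra |]. field; lra.
- rewrite Rmin_left, Rmax_right by trivial; intros x Hx.
  apply (ex_derive_continuous (fun x => / x ^ 4)); auto_derive.
  apply (pow_nonzero x 4); lra.
Qed.

Lemma exists_upper_bound (bs : list box) : exists H, 1 <= H /\ forall b, In b bs -> hi0 b <= H.
Proof.
induction bs as [| b bs (H & H1 & HH)]; [exists 1; split; [lra | intros b []] |].
exists (Rmax H (hi0 b)); split; [eapply Rle_trans; [exact H1 | apply Rmax_l] |].
intros b' [<- | Hb']; [apply Rmax_r | eapply Rle_trans; [apply HH, Hb' | apply Rmax_l]].
Qed.

(* Fubini: the multiplicity bound is integrated one coordinate at a time. *)
Lemma cusp_region_volume : hvol_le cusp_region (8 * (64 / 3)).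
Proof.
intros bs Hbs Hdis.
assert (B : forall b, In b bs -> 1 / 4 <= lo0 b /\ lo0 b <= hi0 b /\
   (-1 <= lo1 b /\ lo1 b <= hi1 b /\ hi1 b <= 1) /\
   (-1 <= lo2 b /\ lo2 b <= hi2 b /\ hi2 b <= 1) /\
   (-1 <= lo3 b /\ lo3 b <= hi3 b /\ hi3 b <= 1)).
{ intros b Hb; destruct (Hbs b Hb) as ((V0 & V1 & V2 & V3) & Hin).
  destruct (Hin (Q (lo0 b) (lo1 b) (lo2 b) (lo3 b))) as (L0 & L1 & L2 & L3);
    [red; simpl; lra |].
  destruct (Hin (Q (hi0 b) (hi1 b) (hi2 b) (hi3 b))) as (M0 & M1 & M2 & M3);
    [red; simpl; lra |].
  simpl in *; lra. }
(* The region is unbounded upwards; a common bound on the heights of the finitely many boxes makes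
   the last integral proper, and the final estimate does not depend on it. *)
destruct (exists_upper_bound bs) as (H & H1 & HH).
pose (F := fun x => - / (3 * x ^ 3)).
assert (S3 : forall x0 x1 x2,
  sum_over bs (fun b => ind (lo0 b) (hi0 b) x0 * ind (lo1 b) (hi1 b) x1 *
     ind (lo2 b) (hi2 b) x2 * (hi3 b - lo3 b)) <= 2).
{ intros x0 x1 x2; replace 2 with (1 * (1 - -1)) by ring.
  apply (slice_sum_le (fun x => x) (fun _ => 1) (-1) 1); try lra.
  - intros; lra.
  - intros; apply is_RInt_cst; ring.
  - intros b Hb; apply (B b Hb).
  - intros x3 _; exact (disjoint_multiplicity bs (Q x0 x1 x2 x3) Hdis). }
assert (S2 : forall x0 x1,
  sum_over bs (fun b => ind (lo0 b) (hi0 b) x0 * ind (lo1 b) (hi1 b) x1 *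
     (hi3 b - lo3 b) * (hi2 b - lo2 b)) <= 4).
{ intros x0 x1; replace 4 with (2 * (1 - -1)) by ring.
  apply (slice_sum_le (fun x => x) (fun _ => 1) (-1) 1); try lra.
  - intros; lra.
  - intros; apply is_RInt_cst; ring.
  - intros b Hb; apply (B b Hb).
  - intros x2 _; eapply Rle_trans; [| apply (S3 x0 x1 x2)]; right.
    apply sum_over_ext; intros; ring. }
assert (S1 : forall x0,
  sum_over bs (fun b => ind (lo0 b) (hi0 b) x0 *
     (hi3 b - lo3 b) * (hi2 b - lo2 b) * (hi1 b - lo1 b)) <= 8).
{ intros x0; replace 8 with (4 * (1 - -1)) by ring.
  apply (slice_sum_le (fun x => x) (fun _ => 1) (-1) 1); try lra.
  - intros; lra.
  - intros; apply is_RInt_cst; ring.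
  - intros b Hb; apply (B b Hb).
  - intros x1 _; eapply Rle_trans; [| apply (S2 x0 x1)]; right.
    apply sum_over_ext; intros; ring. }
apply Rle_trans with (8 * (F H - F (1 / 4))).
- eapply Rle_trans; [| apply (slice_sum_le F (fun x => / x ^ 4) (1 / 4) H) with
    (bs := bs) (lo := lo0) (hi := hi0)
    (c := fun b => (hi3 b - lo3 b) * (hi2 b - lo2 b) * (hi1 b - lo1 b))].
  + right; apply sum_over_ext; intros b Hb; unfold hvol_box, F.
    destruct (B b Hb) as (P1 & P2 & _); field; split; nra.
  + intros x Hx; apply Rlt_le, Rinv_0_lt_compat, pow_lt; lra.
  + intros a b Ha Hab _; apply cusp_weight_int; trivial.
  + lra.
  + intros b Hb; destruct (B b Hb) as (P1 & P2 & _); auto.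
  + intros x0 _; eapply Rle_trans; [| apply (S1 x0)]; right.
    apply sum_over_ext; intros; ring.
(* 64/3 is the integral of x^-4 from 1/4 to infinity, and 8 is the volume of the cube of side 2. *)
- assert (0 < / (3 * H ^ 3)).
  { apply Rinv_0_lt_compat, Rmult_lt_0_compat; [lra | apply pow_lt; lra]. }
  unfold F; replace (/ (3 * (1 / 4) ^ 3)) with (64 / 3) by field; lra.
Qed.

Lemma Gamma_finite_covolume : finite_covolume Gamma3434.
Proof.
exists cusp_region, (8 * (64 / 3)).
split; [exact cusp_region_open | split; [| split]].
- intros q (Hq & _); unfold inH; lra.
- exact cusp_region_volume.
- exact cusp_region_covers.
Qed.

(** * Invariants separating the cosets *)

(** The support of e_i + e_j with i, j different from k. On the radical the form modulo 2 is u1 + u2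
    + u3, and these sums are its only nonzero vectors where the form vanishes; hence a group
    preserving the form permutes them. *)
Definition odd_at (k i : axis) : bool :=
  match k, i with I1, I1 | I2, I2 | I3, I3 => false | _, _ => true end.

Definition par (c : bool) (x : R) : Prop :=
  exists z : Z, x = 2 * IZR z + (if c then 1 else 0).

(* The mod 2 reduction of the quadratic form a n - |u|^2 on Z^5 has a polar form with
   radical {a = n = 0}; [rel k] says that X p - X q reduces to the radical vector
   e_i + e_j with {i, j, k} = {1, 2, 3}. Gamma permutes these three vectors. *)
Definition rel (k : axis) (p q : quat) : Prop :=
  par false (Xa p - Xa q) /\ par false (Xn p - Xn q) /\
  forall i, par (odd_at k i) (Xu i p - Xu i q).

Lemma par_unique (c d : bool) (x : R) : par c x -> par d x -> c = d.
Proof.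
intros [y ->] [z E]; destruct c, d; trivial; exfalso.
- assert (H : IZR (2 * y + 1) = IZR (2 * z)) by (rewrite plus_IZR, !mult_IZR; lra).
  apply eq_IZR in H; lia.
- assert (H : IZR (2 * y) = IZR (2 * z + 1)) by (rewrite plus_IZR, !mult_IZR; lra).
  apply eq_IZR in H; lia.
Qed.

Lemma par_even_add (c : bool) (x y : R) : par false x -> par c y -> par c (x + y).
Proof. intros [a ->] [b ->]; exists (a + b)%Z; rewrite plus_IZR; lra. Qed.

Lemma par_opp (c : bool) (x : R) : par c x -> par c (- x).
Proof.
intros [a ->]; destruct c; [exists (- a - 1)%Z; rewrite minus_IZR, opp_IZR; lra |].
exists (- a)%Z; rewrite opp_IZR; lra.
Qed.

Lemma par_sg (b c : bool) (x : R) : par c x -> par c (sg b * x).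
Proof.
intros H; destruct b; [replace (sg true * x) with (- x) by (simpl; ring); apply par_opp, H |].
replace (sg false * x) with x by (simpl; ring); exact H.
Qed.

Lemma par_even_mul (n x : R) : isZ n -> par false x -> par false (n * x).
Proof. intros [m ->] [a ->]; exists (m * a)%Z; rewrite mult_IZR; lra. Qed.

(** This is why translations act trivially on the radical: the term 2 w.u that they add to [Xn] is
    even whatever the parity of u. *)
Lemma par_double (c : bool) (n x : R) : isZ n -> par c x -> par false (2 * (n * x)).
Proof.
intros [m ->] [a ->].
exists (m * (2 * a + if c then 1 else 0))%Z; rewrite mult_IZR, plus_IZR, mult_IZR.
destruct c; lra.
Qed.

Lemma rel_axis_unique (k l : axis) (p q : quat) : rel k p q -> rel l p q -> k = l.
Proof.
intros (_ & _ & Hk) (_ & _ & Hl).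
pose proof (par_unique _ _ _ (Hk I1) (Hl I1)); pose proof (par_unique _ _ _ (Hk I2) (Hl I2)).
pose proof (par_unique _ _ _ (Hk I3) (Hl I3)); destruct k, l; simpl in *; congruence.
Qed.

Lemma rel_exists (k : axis) : exists p q, inH p /\ inH q /\ rel k p q.
Proof.
destruct k;
  [exists (Q 1 0 1 0), (Q 1 0 0 1) | exists (Q 1 1 0 0), (Q 1 0 0 1)
  | exists (Q 1 1 0 0), (Q 1 0 1 0)];
  (split; [unfold inH; simpl; lra | split; [unfold inH; simpl; lra |]]);
  (split; [exists 0%Z; unfold Xa; simpl; field |]);
  (split; [exists 0%Z; unfold Xn, qnorm2; simpl; field |]);
  intros []; unfold Xu; simpl;
  first [exists 0%Z; simpl; field; fail | exists (-1)%Z; simpl; field].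
Qed.

(** * The determinant of five points *)

Section Determinant.

Variables a b c d e : nat -> R.

Definition det2 (i j : nat) : R := d i * e j - d j * e i.
Definition det3 (i j k : nat) : R := c i * det2 j k - c j * det2 i k + c k * det2 i j.
Definition det4 (i j k l : nat) : R :=
  b i * det3 j k l - b j * det3 i k l + b k * det3 i j l - b l * det3 i j k.
Definition det5 : R :=
  a 0%nat * det4 1 2 3 4 - a 1%nat * det4 0 2 3 4 + a 2%nat * det4 0 1 3 4
  - a 3%nat * det4 0 1 2 4 + a 4%nat * det4 0 1 2 3.

End Determinant.

Lemma det5_ext (a b c d e a' b' c' d' e' : nat -> R) :
  (forall m, a m = a' m) -> (forall m, b m = b' m) -> (forall m, c m = c' m) ->
  (forall m, d m = d' m) -> (forall m, e m = e' m) -> det5 a b c d e = det5 a' b' c' d' e'.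
Proof.
intros Ha Hb Hc Hd He; unfold det5, det4, det3, det2.
rewrite !Ha, !Hb, !Hc, !Hd, !He; reflexivity.
Qed.

Ltac det5_ring := unfold det5, det4, det3, det2; ring.

Lemma det5_swap (a b c d e : nat -> R) : det5 b a c d e = - det5 a b c d e.
Proof. det5_ring. Qed.

Lemma det5_add_b (x y z t : R) (a b c d e : nat -> R) :
  det5 a (fun m => b m + (x * a m + y * c m + z * d m + t * e m)) c d e = det5 a b c d e.
Proof. det5_ring. Qed.

Lemma det5_add_cde (x y z : R) (a b c d e : nat -> R) :
  det5 a b (fun m => c m + x * a m) (fun m => d m + y * a m) (fun m => e m + z * a m)
  = det5 a b c d e.
Proof. det5_ring. Qed.

Lemma det5_scale (x y z : R) (a b c d e : nat -> R) :
  det5 a b (fun m => x * c m) (fun m => y * d m) (fun m => z * e m)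
  = x * y * z * det5 a b c d e.
Proof. det5_ring. Qed.

Definition perm_sign (p : axis -> axis) : Z :=
  match p I1, p I2, p I3 with
  | I1, I2, I3 | I2, I3, I1 | I3, I1, I2 => 1
  | I2, I1, I3 | I1, I3, I2 | I3, I2, I1 => -1
  | _, _, _ => 0
  end.

Lemma det5_perm (p : axis -> axis) (a b : nat -> R) (c : axis -> nat -> R) : perm p ->
  det5 a b (c (p I1)) (c (p I2)) (c (p I3)) = IZR (perm_sign p) * det5 a b (c I1) (c I2) (c I3).
Proof.
intros Hp; unfold perm_sign; perm_cases p Hp; det5_ring.
Qed.

(** The maps are functions on quaternions, not matrices. The determinant of the linear action on X
    is read off as the factor by which this signed volume of five points is multiplied. *)
Definition orient (qs : nat -> quat) : R :=
  det5 (fun m => Xa (qs m)) (fun m => Xn (qs m)) (fun m => Xu I1 (qs m))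
       (fun m => Xu I2 (qs m)) (fun m => Xu I3 (qs m)).

Definition frame (m : nat) : quat :=
  match m with
  | 0 => Q 1 0 0 0 | 1 => Q 1 1 0 0 | 2 => Q 1 0 1 0 | 3 => Q 1 0 0 1
  | _ => Q (1/2) (1/2) 0 0
  end.

Lemma frame_inH (m : nat) : inH (frame m).
Proof. unfold frame, inH; do 4 (destruct m as [| m]; [simpl; lra |]); simpl; lra. Qed.

Lemma orient_frame : orient frame <> 0.
Proof.
unfold orient, det5, det4, det3, det2, Xa, Xn, Xu, qnorm2; simpl; lra.
Qed.

(* The invariant separating the cosets: the permutation induced on the radical vectors,
   and the determinant of the linear action on the coordinates (Xa, Xn, Xu). *)
Definition lab (g : quat -> quat) (p : axis -> axis) (s : Z) : Prop :=
  (forall k q q', inH q -> inH q' -> rel (p k) q q' -> rel k (g q) (g q')) /\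
  (forall qs, (forall m, inH (qs m)) -> orient (fun m => g (qs m)) = IZR s * orient qs).

Lemma lab_id : lab (fun q => q) (fun k => k) 1.
Proof. split; auto; intros; rewrite Rmult_1_l; reflexivity. Qed.

(** The permutations compose in reverse order because [lab] pulls radical vectors back; with this
    convention the label of [sp p b] is [p] itself. *)
Lemma lab_compose (g h : quat -> quat) (p p' : axis -> axis) (s s' : Z) :
  preservesH h -> lab g p s -> lab h p' s' ->
  lab (compose g h) (fun k => p' (p k)) (s * s').
Proof.
intros Hh [g1 g2] [h1 h2]; unfold compose; split.
- intros k q q' Hq Hq' H; apply g1; auto.
- intros qs Hqs; rewrite (g2 (fun m => h (qs m))), h2, mult_IZR by auto; ring.
Qed.

Lemma lab_eqH (f g : quat -> quat) (p : axis -> axis) (s : Z) :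
  eqH f g -> lab g p s -> lab f p s.
Proof.
intros E [g1 g2]; split.
- intros k q q' Hq Hq' H; rewrite !E; auto.
- intros qs Hqs; rewrite <- g2 by trivial; unfold orient.
  apply det5_ext; intros m; rewrite E; auto.
Qed.

Lemma perm_inv (p : axis -> axis) : perm p ->
  exists p', perm p' /\ (forall i, p (p' i) = i) /\ (forall i, p' (p i) = i).
Proof.
intros Hp.
assert (K : exists p', forall i, p (p' i) = i).
{ perm_cases p Hp.
  - exists (fun i => i); intros []; trivial.
  - exists (fun i => match i with I1 => I1 | I2 => I3 | I3 => I2 end); intros []; trivial.
  - exists (fun i => match i with I1 => I2 | I2 => I1 | I3 => I3 end); intros []; trivial.
  - exists (fun i => match i with I1 => I3 | I2 => I1 | I3 => I2 end); intros []; trivial.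
  - exists (fun i => match i with I1 => I2 | I2 => I3 | I3 => I1 end); intros []; trivial.
  - exists (fun i => match i with I1 => I3 | I2 => I2 | I3 => I1 end); intros []; trivial. }
destruct K as [p' E]; exists p'; split; [| split; [exact E |]].
- intros i j H; rewrite <- (E i), <- (E j), H; reflexivity.
- intros i; apply Hp, E.
Qed.

(** Each radical vector is the difference of two actual points and the frame has nonzero volume, so
    both parts of a label can be read off from values of [g]. *)
Lemma lab_unique (g : quat -> quat) (p p' : axis -> axis) (s s' : Z) :
  perm p' -> lab g p s -> lab g p' s' -> (forall k, p k = p' k) /\ s = s'.
Proof.
intros Hp' [r1 o1] [r2 o2]; split.
- intros k; destruct (perm_inv p' Hp') as (i & _ & E & _).
  destruct (rel_exists (p k)) as (q & q' & Hq & Hq' & R).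
  assert (R' : rel (p' (i (p k))) q q') by (rewrite E; exact R).
  apply r1 in R; trivial; apply r2 in R'; trivial.
  rewrite (rel_axis_unique _ _ _ _ R R') at 2; symmetry; apply E.
- apply eq_IZR, (Rmult_eq_reg_r (orient frame)); [| exact orient_frame].
  rewrite <- o1, <- o2; trivial; exact frame_inH.
Qed.

Lemma lab_s_inf : lab s_inf (fun k => k) (-1).
Proof.
split.
- intros k q q' Hq Hq' (Ra & Rn & Ru); split; [| split].
  + rewrite !Xa_s_inf by trivial; exact Rn.
  + rewrite !Xn_s_inf by trivial; exact Ra.
  + intros i; rewrite !Xu_s_inf by trivial; apply Ru.
- intros qs Hqs; unfold orient.
  rewrite (det5_ext _ _ _ _ _ (fun m => Xn (qs m)) (fun m => Xa (qs m))
    (fun m => Xu I1 (qs m)) (fun m => Xu I2 (qs m)) (fun m => Xu I3 (qs m)));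
    try (intros m; auto using Xa_s_inf, Xn_s_inf, Xu_s_inf).
  rewrite det5_swap; ring.
Qed.

Definition sgz (c : bool) : Z := if c then -1 else 1.

Lemma sg_sgz (c : bool) : sg c = IZR (sgz c).
Proof. destruct c; reflexivity. Qed.

Definition sp_sign (p : axis -> axis) (b : axis -> bool) : Z :=
  sgz (b I1) * sgz (b I2) * sgz (b I3) * perm_sign p.

Lemma qnorm2_sp (p : axis -> axis) (b : axis -> bool) (q : quat) :
  perm p -> qnorm2 (sp p b q) = qnorm2 q.
Proof.
intros Hp; unfold qnorm2, sp; simpl.
destruct (b I1), (b I2), (b I3); perm_cases p Hp; simpl; ring.
Qed.

Lemma Xn_sp (p : axis -> axis) (b : axis -> bool) (q : quat) : perm p ->
  Xn (sp p b q) = Xn q.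
Proof. intros Hp; unfold Xn; rewrite qnorm2_sp by trivial; reflexivity. Qed.

Lemma Xu_sp (p : axis -> axis) (b : axis -> bool) (q : quat) (i : axis) :
  Xu i (sp p b q) = sg (b i) * Xu (p i) q.
Proof. unfold Xu; rewrite coord_sp; simpl; unfold Rdiv; ring. Qed.

Lemma odd_at_perm (p : axis -> axis) (k i : axis) : perm p ->
  odd_at (p k) (p i) = odd_at k i.
Proof. intros Hp; perm_cases p Hp; destruct k, i; rewrite ?P1, ?P2, ?P3; reflexivity. Qed.

Lemma lab_sp (p : axis -> axis) (b : axis -> bool) : perm p -> lab (sp p b) p (sp_sign p b).
Proof.
intros Hp; split.
- intros k q q' Hq Hq' (Ra & Rn & Ru); split; [exact Ra | split].
  + rewrite !Xn_sp by trivial; exact Rn.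
  + intros i; rewrite !Xu_sp; specialize (Ru (p i)); rewrite odd_at_perm in Ru by trivial.
    replace (sg (b i) * Xu (p i) q - sg (b i) * Xu (p i) q')
      with (sg (b i) * (Xu (p i) q - Xu (p i) q')) by ring.
    apply par_sg, Ru.
- intros qs Hqs; unfold orient.
  rewrite (det5_ext _ _ _ _ _ (fun m => Xa (qs m)) (fun m => Xn (qs m))
    (fun m => sg (b I1) * Xu (p I1) (qs m)) (fun m => sg (b I2) * Xu (p I2) (qs m))
    (fun m => sg (b I3) * Xu (p I3) (qs m)));
    try (intros m; auto using Xu_sp, Xn_sp).
  rewrite det5_scale, (det5_perm p _ _ (fun i m => Xu i (qs m))) by trivial.
  unfold sp_sign; rewrite !mult_IZR, !sg_sgz; ring.
Qed.

Lemma Xn_tau (w q : quat) : qr w = 0 -> inH q -> Xn (tau w q) =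
  Xn q + (qnorm2 w * Xa q + 2 * qi w * Xu I1 q + 2 * qj w * Xu I2 q + 2 * qk w * Xu I3 q).
Proof.
unfold inH, Xn, Xa, Xu, qnorm2, tau; simpl; intros -> Hq; field; lra.
Qed.

Lemma Xa_tau (w q : quat) : qr w = 0 -> Xa (tau w q) = Xa q.
Proof. unfold Xa, tau; simpl; intros ->; rewrite Rplus_0_r; reflexivity. Qed.

Lemma Xu_tau (w q : quat) (i : axis) : qr w = 0 ->
  Xu i (tau w q) = Xu i q + coord w i * Xa q.
Proof.
unfold Xa, Xu, tau; destruct i; simpl; intros ->; rewrite Rplus_0_r; unfold Rdiv; ring.
Qed.

Lemma lipschitz_coord (w : quat) (i : axis) : lipschitz_imag w -> isZ (coord w i).
Proof. intros (_ & b & c & d & Hb & Hc & Hd); destruct i; eexists; eassumption. Qed.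

Lemma lipschitz_of_coord (w : quat) : qr w = 0 -> (forall i, isZ (coord w i)) ->
  lipschitz_imag w.
Proof.
intros Hr Hc; destruct (Hc I1) as [b Hb], (Hc I2) as [c Hc'], (Hc I3) as [d Hd].
split; [exact Hr | exists b, c, d; auto].
Qed.

Lemma lab_tau (w : quat) : lipschitz_imag w -> lab (tau w) (fun k => k) 1.
Proof.
intros Hw; pose proof (proj1 Hw) as Hr.
pose proof (lipschitz_coord w I1 Hw) as Z1; pose proof (lipschitz_coord w I2 Hw) as Z2.
pose proof (lipschitz_coord w I3 Hw) as Z3; simpl in Z1, Z2, Z3.
split.
- intros k q q' Hq Hq' (Ra & Rn & Ru); split; [| split].
  + rewrite !Xa_tau by trivial; exact Ra.
  + rewrite !Xn_tau by trivial.
    replace (_ - _) with (qnorm2 w * (Xa q - Xa q') + (2 * (qi w * (Xu I1 q - Xu I1 q')) +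
      (2 * (qj w * (Xu I2 q - Xu I2 q')) + (2 * (qk w * (Xu I3 q - Xu I3 q')) +
      (Xn q - Xn q'))))) by ring.
    apply par_even_add.
    * apply par_even_mul; [unfold qnorm2; rewrite Hr | exact Ra].
      pose proof (isZ_IZR 0); auto 8 using isZ_add, isZ_mul.
    * apply par_even_add; [exact (par_double _ _ _ Z1 (Ru I1)) |].
      apply par_even_add; [exact (par_double _ _ _ Z2 (Ru I2)) |].
      apply par_even_add; [exact (par_double _ _ _ Z3 (Ru I3)) | exact Rn].
  + intros i; rewrite !Xu_tau by trivial.
    replace (_ - _) with (coord w i * (Xa q - Xa q') + (Xu i q - Xu i q')) by ring.
    apply par_even_add; [apply par_even_mul; trivial; apply lipschitz_coord, Hw | apply Ru].
- intros qs Hqs; rewrite Rmult_1_l; unfold orient.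
  rewrite (det5_ext _ _ _ _ _ (fun m => Xa (qs m))
    (fun m => Xn (qs m) + (qnorm2 w * Xa (qs m) + 2 * qi w * Xu I1 (qs m)
       + 2 * qj w * Xu I2 (qs m) + 2 * qk w * Xu I3 (qs m)))
    (fun m => Xu I1 (qs m) + qi w * Xa (qs m)) (fun m => Xu I2 (qs m) + qj w * Xa (qs m))
    (fun m => Xu I3 (qs m) + qk w * Xa (qs m)));
    try (intros m; first [apply Xa_tau | apply Xn_tau | apply Xu_tau]; auto).
  rewrite (det5_add_cde (qi w) (qj w) (qk w) (fun m => Xa (qs m)) _
    (fun m => Xu I1 (qs m)) (fun m => Xu I2 (qs m)) (fun m => Xu I3 (qs m))).
  apply (det5_add_b _ _ _ _ (fun m => Xa (qs m)) (fun m => Xn (qs m))).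
Qed.

Definition all_neg : quat -> quat := sp (fun i => i) (fun _ => true).

Lemma perm_id : perm (fun i => i).
Proof. intros i j H; exact H. Qed.

Lemma T_map_s_inf (q : quat) : T_map q = all_neg (s_inf q).
Proof. apply quat_ext; simpl; unfold Rdiv; ring. Qed.

Lemma s_inf_T_map (q : quat) : s_inf q = all_neg (T_map q).
Proof. apply quat_ext; simpl; unfold Rdiv; ring. Qed.

Lemma T_preservesH : preservesH T_map.
Proof. intros q Hq; rewrite T_map_s_inf; apply sp_preservesH, s_inf_preservesH, Hq. Qed.

(** The inversion swaps [Xa] and [Xn], with determinant -1; the three sign changes in T supply a
    second -1. *)
Lemma lab_T : lab T_map (fun k => k) 1.
Proof.
apply (lab_eqH _ (compose all_neg s_inf)); [intros q _; apply T_map_s_inf |].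
exact (lab_compose _ _ _ _ _ _ s_inf_preservesH (lab_sp _ _ perm_id) lab_s_inf).
Qed.

Lemma tau_preservesH (w : quat) : lipschitz_imag w -> preservesH (tau w).
Proof. intros [Hr _] q Hq; unfold inH in *; simpl; lra. Qed.

Lemma gens_PSL2L_preservesH (s : quat -> quat) : gens_PSL2L s -> preservesH s.
Proof. intros [-> | (w & Hw & ->)]; auto using T_preservesH, tau_preservesH. Qed.

Lemma PSL2L_compose (f g : quat -> quat) : PSL2L f -> PSL2L g -> PSL2L (compose f g).
Proof. apply generated_compose; exact gens_PSL2L_preservesH. Qed.

Lemma PSL2L_T : PSL2L T_map.
Proof. apply generated_base; left; reflexivity. Qed.

Lemma PSL2L_tau (w : quat) : lipschitz_imag w -> PSL2L (tau w).
Proof. intros Hw; apply generated_base; right; exists w; auto. Qed.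

Lemma generated_preservesH (S : (quat -> quat) -> Prop) (f : quat -> quat) :
  (forall s, S s -> preservesH s) -> generated S f -> preservesH f.
Proof.
intros HS (w & Hw & E) q Hq; rewrite E by trivial; apply (words_preservesH S); trivial.
Qed.

Lemma PSL2L_preservesH (f : quat -> quat) : PSL2L f -> preservesH f.
Proof. apply generated_preservesH; exact gens_PSL2L_preservesH. Qed.

Lemma PSL2L_lab (f : quat -> quat) : PSL2L f -> lab f (fun k => k) 1.
Proof.
intros (w & Hw & E); apply (lab_eqH _ _ _ _ E); clear f E.
induction Hw as [| s w Hs Hw IH]; [exact lab_id |].
refine (lab_compose s w (fun k => k) (fun k => k) 1 1 _ _ IH).
- apply (words_preservesH gens_PSL2L); trivial; exact gens_PSL2L_preservesH.
- destruct Hs as [-> | (v & Hv & ->)]; [exact lab_T | exact (lab_tau v Hv)].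
Qed.

(** * Even sign changes and Hurwitz rotations *)

Lemma T_map_norm (q : quat) (n : R) : qnorm2 q = n ->
  T_map q = Q (qr q / n) (- qi q / n) (- qj q / n) (- qk q / n).
Proof. intros <-; reflexivity. Qed.

Definition T_tau_cube (w q : quat) : quat :=
  T_map (tau w (T_map (tau w (T_map (tau w q))))).

(* With M the matrix (0 1; 1 i) of T tau_i, M^3 = diag(i, i), which acts as
   conjugation by i. *)
Lemma T_tau_cube_i (q : quat) : inH q ->
  T_tau_cube (imag 1 0 0) q
  = sp (fun i => i) (fun i => match i with I1 => false | _ => true end) q.
Proof.
intros Hq; pose proof (qnorm2_pos q Hq) as N.
pose proof (qnorm2_pos (tau (imag 1 0 0) q)) as M.
destruct q as [r x y z]; unfold inH in Hq, M; simpl in Hq, M.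
specialize (M ltac:(lra)).
set (n := qnorm2 (Q r x y z)) in *; set (m := qnorm2 (tau (imag 1 0 0) (Q r x y z))) in *.
assert (Em : m = n + 2 * x + 1) by (unfold m, n, qnorm2; simpl; ring).
assert (En : r * r = n - x * x - y * y - z * z) by (unfold n, qnorm2; simpl; ring).
(* The norms met by the three inversions are m = |q + i|^2, then n/m, then 1/n, where n = |q|^2 and
   m = n + 2x + 1; so all denominators cancel at the end. *)
assert (S1 : T_map (tau (imag 1 0 0) (Q r x y z))
  = Q (r / m) (- (x + 1) / m) (- y / m) (- z / m)).
{ rewrite (T_map_norm _ m eq_refl); apply quat_ext; simpl; field; lra. }
assert (S2 : T_map (tau (imag 1 0 0) (Q (r / m) (- (x + 1) / m) (- y / m) (- z / m)))
  = Q (r / n) (- (n + x) / n) (y / n) (z / n)).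
{ rewrite (T_map_norm _ (n / m)).
  - apply quat_ext; simpl; field_simplify_eq; lra || (rewrite Em; ring).
  - unfold qnorm2; simpl.
    transitivity ((r * r + (m - x - 1) * (m - x - 1) + y * y + z * z) / (m * m));
      [field; lra |].
    rewrite En; replace (m - x - 1) with (n + x) by lra.
    transitivity (n * (n + 2 * x + 1) / (m * m)); [f_equal; ring |].
    rewrite <- Em; field; lra. }
unfold T_tau_cube; rewrite S1, S2, (T_map_norm _ (/ n)).
- apply quat_ext; simpl; field; lra.
- unfold qnorm2; simpl.
  transitivity ((r * r + x * x + y * y + z * z) / (n * n)); [field; lra |].
  rewrite En; field; lra.
Qed.

Lemma T_sp (p : axis -> axis) (b : axis -> bool) (q : quat) : perm p ->
  T_map (sp p b q) = sp p b (T_map q).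
Proof.
intros Hp; unfold T_map, qinv; rewrite qnorm2_sp by trivial.
assert (E : forall i, coord (Q (qr q / qnorm2 q) (- qi q / qnorm2 q) (- qj q / qnorm2 q)
  (- qk q / qnorm2 q)) i = - coord q i / qnorm2 q) by (intros []; reflexivity).
apply coord_ext; [reflexivity |].
intros i; rewrite coord_sp, E; destruct i; simpl; unfold Rdiv; ring.
Qed.

Lemma tau_sp (p : axis -> axis) (b : axis -> bool) (w : quat) : perm p -> lipschitz_imag w ->
  exists w', lipschitz_imag w' /\ forall q, tau w (sp p b q) = sp p b (tau w' q).
Proof.
intros Hp Hw; destruct (perm_inv p Hp) as (p' & _ & _ & E).
(* The witness is the image of [w] under the inverse signed permutation, which again has integral
   coordinates. *)
exists (sp p' (fun i => b (p' i)) w); split.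
- apply lipschitz_of_coord; [apply Hw |].
  intros i; rewrite coord_sp; apply isZ_mul; [rewrite sg_sgz; apply isZ_IZR |].
  apply lipschitz_coord, Hw.
- intros q.
  assert (A : forall v w i, coord (tau v w) i = coord w i + coord v i)
    by (intros v u []; reflexivity).
  apply coord_ext; [simpl; ring |].
  intros i; rewrite A, !coord_sp, A, coord_sp, E.
  rewrite Rmult_plus_distr_l, <- Rmult_assoc, sg_sqr; ring.
Qed.

Definition even_signs (c : axis -> bool) : Prop := xorb (c I1) (xorb (c I2) (c I3)) = false.

Lemma lipschitz_unit_i : lipschitz_imag (imag 1 0 0).
Proof. apply lipschitz_of_coord; [reflexivity | intros []]; apply isZ_IZR. Qed.

Lemma lipschitz_unit_j : lipschitz_imag (imag 0 1 0).
Proof. apply lipschitz_of_coord; [reflexivity | intros []]; apply isZ_IZR. Qed.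

Lemma PSL2L_T_tau_cube (w : quat) : lipschitz_imag w -> PSL2L (T_tau_cube w).
Proof.
intros Hw; pose proof (PSL2L_compose _ _ PSL2L_T (PSL2L_tau w Hw)) as K.
exact (PSL2L_compose _ _ K (PSL2L_compose _ _ K K)).
Qed.

Lemma T_tau_cube_j (q : quat) : inH q ->
  T_tau_cube (imag 0 1 0) q
  = sp (fun i => i) (fun i => match i with I2 => false | _ => true end) q.
Proof.
intros Hq; assert (E : q = s_B (s_B q)) by (destruct q; reflexivity).
assert (S : forall q, tau (imag 0 1 0) (s_B q) = s_B (tau (imag 1 0 0) q))
  by (intros; apply quat_ext; simpl; ring).
assert (T : forall q, T_map (s_B q) = s_B (T_map q)).
{ intros q'; unfold T_map, qinv.
  replace (qnorm2 (s_B q')) with (qnorm2 q') by (unfold qnorm2; simpl; ring); reflexivity. }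
rewrite E at 1; unfold T_tau_cube; rewrite !S, !T, !S, !T, !S, !T.
fold (T_tau_cube (imag 1 0 0) (s_B q)); rewrite T_tau_cube_i by exact Hq.
reflexivity.
Qed.

(** The even sign changes form a Klein four-group: the conjugations by 1, i, j and k. Those by i and
    j come from [T_tau_cube], and k is their product. *)
Lemma PSL2L_even_signs (c : axis -> bool) : even_signs c -> PSL2L (sp (fun i => i) c).
Proof.
pose proof (PSL2L_T_tau_cube _ lipschitz_unit_i) as Ki.
pose proof (PSL2L_T_tau_cube _ lipschitz_unit_j) as Kj.
pose proof (PSL2L_compose _ _ Ki Kj) as Kk.
unfold even_signs; destruct (c I1) eqn:C1, (c I2) eqn:C2, (c I3) eqn:C3;
  try discriminate; intros _.
- eapply generated_eqH; [| exact Kk]; intros q Hq; unfold compose.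
  rewrite T_tau_cube_j, T_tau_cube_i by trivial; rewrite sp_comp.
  apply sp_ext; [reflexivity | intros []; trivial].
- eapply generated_eqH; [| exact Kj]; intros q Hq.
  rewrite T_tau_cube_j by trivial; apply sp_ext; [reflexivity | intros []; trivial].
- eapply generated_eqH; [| exact Ki]; intros q Hq.
  rewrite T_tau_cube_i by trivial; apply sp_ext; [reflexivity | intros []; trivial].
- eapply generated_eqH; [| apply generated_id]; intros q Hq.
  rewrite <- sp_id; apply sp_ext; [reflexivity | intros []; trivial].
Qed.

Definition next (i : axis) : axis := match i with I1 => I2 | I2 => I3 | I3 => I1 end.

(** The permutations of three axes commuting with the 3-cycle are its powers. In this form closure
    under composition is immediate. *)
Definition cyc (p : axis -> axis) : Prop := forall i, p (next i) = next (p i).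

Lemma cyc_perm (p : axis -> axis) : cyc p -> perm p.
Proof.
intros Hp i j; pose proof (Hp I1) as H1; pose proof (Hp I2) as H2; simpl in H1, H2.
destruct i, j, (p I1); simpl in H1; rewrite H1 in H2; simpl in H2;
  rewrite ?H1, ?H2; trivial; discriminate.
Qed.

Lemma cyc_sign (p : axis -> axis) (c : axis -> bool) : cyc p -> even_signs c ->
  sp_sign p c = 1%Z.
Proof.
intros Hp; pose proof (Hp I1) as H1; pose proof (Hp I2) as H2; simpl in H1, H2.
unfold even_signs, sp_sign, perm_sign.
destruct (p I1); simpl in H1; rewrite H1 in H2; simpl in H2; rewrite H1, H2;
  destruct (c I1), (c I2), (c I3); intros E; reflexivity || discriminate.
Qed.

Lemma conj_by_coords (u q : quat) : qnorm2 u = 1 ->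
  conj_by u q = Q (qr q)
   ((qr u * qr u + qi u * qi u - qj u * qj u - qk u * qk u) * qi q
     + 2 * (qi u * qj u - qr u * qk u) * qj q + 2 * (qi u * qk u + qr u * qj u) * qk q)
   (2 * (qi u * qj u + qr u * qk u) * qi q
     + (qr u * qr u - qi u * qi u + qj u * qj u - qk u * qk u) * qj q
     + 2 * (qj u * qk u - qr u * qi u) * qk q)
   (2 * (qi u * qk u - qr u * qj u) * qi q + 2 * (qj u * qk u + qr u * qi u) * qj q
     + (qr u * qr u - qi u * qi u - qj u * qj u + qk u * qk u) * qk q).
Proof.
intros H; unfold conj_by, qinv; rewrite H.
apply quat_ext; simpl; try field.
transitivity (qnorm2 u * qr q); [unfold qnorm2; field | rewrite H; ring].
Qed.

(** Modulo sign the 24 units give the 12 rotations of a tetrahedron: 1, i, j, k act by even sign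
    changes, and the half-integral units by turns of order 3 about the diagonals of the cube. *)
Lemma hurwitz_rotation (u : quat) : hurwitz_unit u ->
  exists p c, cyc p /\ even_signs c /\ forall q, conj_by u q = sp p c q.
Proof.
pose (c0 := fun _ : axis => false).
pose (c1 := fun i => match i with I1 => false | _ => true end).
pose (c2 := fun i => match i with I2 => false | _ => true end).
pose (c3 := fun i => match i with I3 => false | _ => true end).
assert (C : even_signs c0 /\ even_signs c1 /\ even_signs c2 /\ even_signs c3)
  by (repeat split).
assert (P0 : cyc (fun i => i)) by (intros i; reflexivity).
assert (P1 : cyc next) by (intros i; reflexivity).
assert (P2 : cyc (fun i => next (next i))) by (intros i; reflexivity).
intros Hu.
assert (N : qnorm2 u = 1).
{ unfold hurwitz_unit, pm1 in Hu; unfold qnorm2.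
  destruct Hu as [H | [H | [H | [H | H]]]]; destruct H as (H1 & H2 & H3 & H4);
    rewrite ?H1, ?H2, ?H3, ?H4.
  1-4: repeat match goal with H : _ \/ _ |- _ => destruct H as [H | H]; rewrite ?H end; lra.
  assert (K : forall x, 2 * x = 1 \/ 2 * x = -1 -> x * x = 1 / 4)
    by (intros x [K | K]; nra).
  rewrite !K by trivial; lra. }
assert (K : forall p c,
  (forall q, conj_by u q = sp p c q) -> cyc p -> even_signs c ->
  exists p c, cyc p /\ even_signs c /\ forall q, conj_by u q = sp p c q)
  by (intros p c; exists p, c; auto).
destruct C as (C0 & C1 & C2 & C3).
destruct u as [a b c d]; unfold hurwitz_unit, pm1 in Hu; simpl in Hu.
assert (Half : forall x, 2 * x = 1 \/ 2 * x = -1 -> x = 1 / 2 \/ x = - (1 / 2))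
  by (intros x [Hx | Hx]; [left | right]; lra).
assert (Cases : (a = 1 \/ a = -1) /\ b = 0 /\ c = 0 /\ d = 0 \/
  a = 0 /\ (b = 1 \/ b = -1) /\ c = 0 /\ d = 0 \/
  a = 0 /\ b = 0 /\ (c = 1 \/ c = -1) /\ d = 0 \/
  a = 0 /\ b = 0 /\ c = 0 /\ (d = 1 \/ d = -1) \/
  (a = 1 / 2 \/ a = - (1 / 2)) /\ (b = 1 / 2 \/ b = - (1 / 2)) /\
  (c = 1 / 2 \/ c = - (1 / 2)) /\ (d = 1 / 2 \/ d = - (1 / 2))).
{ destruct Hu as [H | [H | [H | [H | (Ha & Hb & Hc & Hd)]]]]; auto 10. }
clear Hu Half.
Ltac try_rotation K N p c :=
  apply (K p c);
  [ let q := fresh in intros q; rewrite (conj_by_coords _ _ N); destruct q; apply quat_ext; simpl; lra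
  | assumption | assumption ].
destruct Cases as [(Ha & -> & -> & ->) | [(-> & Hb & -> & ->) | [(-> & -> & Hc & ->)
  | [(-> & -> & -> & Hd) | (Ha & Hb & Hc & Hd)]]]].
- destruct Ha as [-> | ->]; try_rotation K N (fun i : axis => i) c0.
- destruct Hb as [-> | ->]; try_rotation K N (fun i : axis => i) c1.
- destruct Hc as [-> | ->]; try_rotation K N (fun i : axis => i) c2.
- destruct Hd as [-> | ->]; try_rotation K N (fun i : axis => i) c3.
- destruct Ha as [-> | ->], Hb as [-> | ->], Hc as [-> | ->], Hd as [-> | ->];
  first [ try_rotation K N next c0 | try_rotation K N next c1
        | try_rotation K N next c2 | try_rotation K N next c3
        | try_rotation K N (fun i => next (next i)) c0
        | try_rotation K N (fun i => next (next i)) c1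
        | try_rotation K N (fun i => next (next i)) c2
        | try_rotation K N (fun i => next (next i)) c3 ].
Qed.

(** * Cosets *)

Lemma conj_by_preservesH (u : quat) : hurwitz_unit u -> preservesH (conj_by u).
Proof.
intros Hu q Hq; destruct (hurwitz_rotation u Hu) as (p & c & _ & _ & E).
rewrite E; exact Hq.
Qed.

Lemma gens_PSL2H_preservesH (s : quat -> quat) : gens_PSL2H s -> preservesH s.
Proof.
intros [H | (u & Hu & ->)]; auto using gens_PSL2L_preservesH, conj_by_preservesH.
Qed.

Lemma PSL2H_compose (f g : quat -> quat) : PSL2H f -> PSL2H g -> PSL2H (compose f g).
Proof. apply generated_compose; exact gens_PSL2H_preservesH. Qed.

Lemma PSL2L_sub_PSL2H : subgroup PSL2L PSL2H.
Proof.
intros f; apply generated_sub;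
  [exact gens_PSL2L_preservesH | exact gens_PSL2H_preservesH |].
intros s Hs; apply generated_base; left; exact Hs.
Qed.

Lemma Gamma_gens_PSL2L (s : quat -> quat) : gens_PSL2L s -> Gamma3434 s.
Proof.
intros [-> | (w & Hw & ->)]; [| apply Gamma_tau, Hw].
apply (Gamma_eqH _ (compose all_neg s_inf)); [intros q _; apply T_map_s_inf |].
apply Gamma_compose; [apply Gamma_signs | apply Gamma_mirror; red; auto].
Qed.

Lemma PSL2H_sub_Gamma : subgroup PSL2H Gamma3434.
Proof.
intros f; apply generated_sub; [exact gens_PSL2H_preservesH | |].
- intros s Hs; apply isometry_preservesH, gens_Gamma_isometry, Hs.
- intros s [Hs | (u & Hu & ->)]; [apply Gamma_gens_PSL2L, Hs |].
  destruct (hurwitz_rotation u Hu) as (p & c & Hp & _ & E).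
  apply (Gamma_eqH _ (sp p c)); [intros q _; apply E | apply Gamma_sp, cyc_perm, Hp].
Qed.

Lemma cyc_compose (p p' : axis -> axis) : cyc p -> cyc p' -> cyc (fun k => p (p' k)).
Proof. intros Hp Hp' i; rewrite Hp', Hp; reflexivity. Qed.

Lemma PSL2H_lab (f : quat -> quat) : PSL2H f -> exists p, cyc p /\ lab f p 1.
Proof.
intros (w & Hw & E).
assert (K : exists p, cyc p /\ lab w p 1).
{ clear f E; induction Hw as [| s w Hs Hw (p & Hp & Lp)].
  - exists (fun k => k); split; [intros i; reflexivity | exact lab_id].
  - assert (Hw' : preservesH w)
      by (apply (words_preservesH gens_PSL2H); trivial; exact gens_PSL2H_preservesH).
    assert (Ks : exists p', cyc p' /\ lab s p' 1).
    { destruct Hs as [Hs | (u & Hu & ->)].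
      - exists (fun k => k); split; [intros i; reflexivity |].
        apply PSL2L_lab, generated_base, Hs.
      - destruct (hurwitz_rotation u Hu) as (p' & c & Hp' & Hc & Es).
        exists p'; split; [exact Hp' |]; apply (lab_eqH _ (sp p' c)); [intros q _; apply Es |].
        rewrite <- (cyc_sign p' c Hp' Hc); apply lab_sp, cyc_perm, Hp'. }
    destruct Ks as (p' & Hp' & Lp'); exists (fun k => p (p' k)).
    split; [apply cyc_compose; trivial |].
    exact (lab_compose s w p' p 1 1 Hw' Lp' Lp). }
destruct K as (p & Hp & Lp); exists p; split; [exact Hp | exact (lab_eqH _ _ _ _ E Lp)].
Qed.

Lemma PSL2H_rotation (p : axis -> axis) (c : axis -> bool) :
  cyc p -> even_signs c -> PSL2H (sp p c).
Proof.
intros Hp Hc; apply (generated_eqH _ _ (compose (sp (fun i => i) c) (sp p (fun _ => false)))).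
{ intros q _; unfold compose; rewrite sp_comp; apply sp_ext; [reflexivity |].
  intros i; rewrite xorb_false_r; reflexivity. }
apply PSL2H_compose; [apply PSL2L_sub_PSL2H, PSL2L_even_signs, Hc |].
(* Conjugation by this unit is the 3-cycle i to j to k to i, which generates the cyclic
   permutations. *)
pose (u := Q (1 / 2) (1 / 2) (1 / 2) (1 / 2)).
assert (Hu : hurwitz_unit u) by (do 4 right; unfold pm1; simpl; lra).
assert (G : PSL2H (conj_by u)) by (apply generated_base; right; exists u; auto).
assert (N : qnorm2 u = 1) by (unfold qnorm2; simpl; lra).
assert (E : forall q, conj_by u q = Q (qr q) (qk q) (qi q) (qj q)).
{ intros q; rewrite (conj_by_coords u q N); apply quat_ext; simpl; field. }
pose proof (Hp I1) as H1; pose proof (Hp I2) as H2; simpl in H1, H2.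
destruct (p I1) eqn:E1; simpl in H1; rewrite H1 in H2; simpl in H2.
- eapply generated_eqH; [| apply generated_id].
  intros q _; unfold sp; rewrite E1, H1, H2; apply quat_ext; simpl; ring.
- eapply generated_eqH; [| exact (PSL2H_compose _ _ G G)].
  intros q _; unfold compose, sp; rewrite !E, E1, H1, H2; apply quat_ext; simpl; ring.
- eapply generated_eqH; [| exact G].
  intros q _; unfold compose, sp; rewrite !E, E1, H1, H2; apply quat_ext; simpl; ring.
Qed.

Definition swap12 (i : axis) : axis := match i with I1 => I2 | I2 => I1 | I3 => I3 end.
Definition swap23 (i : axis) : axis := match i with I1 => I1 | I2 => I3 | I3 => I2 end.

Lemma perm_compose (p p' : axis -> axis) : perm p -> perm p' -> perm (fun k => p (p' k)).
Proof. intros Hp Hp' i j H; apply Hp', Hp, H. Qed.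

Lemma perm_swap12 : perm swap12.
Proof. intros [] []; simpl; congruence. Qed.

Lemma perm_swap23 : perm swap23.
Proof. intros [] []; simpl; congruence. Qed.

(* PSL(2,L) is normalized by the signed permutation matrices, and modulo them the
   generators of Gamma become T and tau_i. *)
Lemma Gamma_normal_form (g : quat -> quat) : Gamma3434 g ->
  exists p b k, perm p /\ PSL2L k /\ eqH g (compose (sp p b) k).
Proof.
rewrite Gamma_mirrors; intros (w & Hw & Ew).
assert (K : exists p b k, perm p /\ PSL2L k /\ eqH w (compose (sp p b) k)).
{ clear g Ew; induction Hw as [| s w Hs _ (p & b & k & Hp & Hk & E)].
  - exists (fun i => i), (fun _ => false), (fun q => q).
    split; [exact perm_id | split; [apply generated_id |]].
    intros q _; symmetry; apply sp_id.
  - assert (Lin : forall p' b', perm p' -> (forall q, s q = sp p' b' q) ->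
      exists p b k, perm p /\ PSL2L k /\ eqH (compose s w) (compose (sp p b) k)).
    { intros p' b' Hp' Es; do 2 eexists; exists k; split; [| split; [exact Hk |]].
      2: { intros q Hq; unfold compose; rewrite E, Es by trivial; apply sp_comp. }
      apply perm_compose; trivial. }
    destruct Hs as [-> | [-> | [-> | [-> | ->]]]].
    + do 2 eexists; exists (compose T_map k); split; [| split].
      3: { intros q Hq; unfold compose; rewrite E by trivial; unfold compose.
        rewrite s_inf_T_map, T_sp by trivial; apply sp_comp. }
      * exact Hp.
      * apply PSL2L_compose; [exact PSL2L_T | exact Hk].
    (* [s_A] is the sign change of the first axis followed by the translation by i; [tau_sp] then
       moves this translation past the signed permutation into the PSL(2,L) factor. *)
    + pose (b' := fun i => match i with I1 => true | _ => false end).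
      destruct (tau_sp (fun i => p i) (fun i => xorb (b' i) (b i)) (imag 1 0 0) Hp
        lipschitz_unit_i) as (w' & Hw' & Ew').
      exists (fun i => p i), (fun i => xorb (b' i) (b i)), (compose (tau w') k).
      split; [exact Hp | split; [apply PSL2L_compose; [apply PSL2L_tau, Hw' | exact Hk] |]].
      intros q Hq; unfold compose; rewrite E by trivial; unfold compose.
      rewrite <- Ew', <- (sp_comp (fun i => i)).
      apply quat_ext; simpl; ring.
    + apply (Lin swap12 (fun _ => false) perm_swap12).
      intros q; apply quat_ext; simpl; ring.
    + apply (Lin swap23 (fun _ => false) perm_swap23).
      intros q; apply quat_ext; simpl; ring.
    + apply (Lin (fun i => i) (fun i => match i with I3 => true | _ => false end) perm_id).
      intros q; apply quat_ext; simpl; ring. }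
destruct K as (p & b & k & Hp & Hk & E); exists p, b, k; split; [exact Hp | split; [exact Hk |]].
intros q Hq; rewrite Ew by trivial; apply E, Hq.
Qed.

(** The normal form in Gamma is refined through the invariants: a label from PSL(2,H) is cyclic with
    determinant 1, and a cyclic permutation has sign 1, so the number of sign changes must be
    even. *)
Lemma PSL2H_normal_form (g : quat -> quat) : PSL2H g ->
  exists p c k, cyc p /\ even_signs c /\ PSL2L k /\ eqH g (compose (sp p c) k).
Proof.
intros Hg; destruct (PSL2H_lab g Hg) as (p' & Hp' & L).
destruct (Gamma_normal_form g (PSL2H_sub_Gamma g Hg)) as (p & b & k & Hp & Hk & E).
pose proof (lab_compose _ _ _ _ _ _ (PSL2L_preservesH k Hk) (lab_sp p b Hp) (PSL2L_lab k Hk))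
  as L'.
apply (lab_eqH _ _ _ _ E) in L'.
destruct (lab_unique _ _ _ _ _ (cyc_perm p' Hp') L' L) as [Ep Es].
assert (Cp : cyc p) by (intros i; rewrite !Ep; apply Hp').
exists p, b, k; repeat split; trivial.
rewrite Z.mul_1_r in Es; revert Es.
pose proof (Cp I1) as H1; pose proof (Cp I2) as H2; simpl in H1, H2.
unfold even_signs, sp_sign, perm_sign.
destruct (p I1); simpl in H1; rewrite H1 in H2; simpl in H2; rewrite H1, H2;
  destruct (b I1), (b I2), (b I3); intros Es; reflexivity || discriminate.
Qed.

(** * Coset representatives and the three indices *)

Definition make_perm (x y z i : axis) : axis :=
  match i with I1 => x | I2 => y | I3 => z end.

(** The identity and a transposition come first: they represent all permutations modulo the cyclic
    ones, so an initial segment of the list also serves for PSL(2,H). *)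
Definition perm_of_nat (n : nat) : axis -> axis :=
  match n with
  | 0 => make_perm I1 I2 I3 | 1 => make_perm I2 I1 I3 | 2 => make_perm I1 I3 I2
  | 3 => make_perm I2 I3 I1 | 4 => make_perm I3 I1 I2 | _ => make_perm I3 I2 I1
  end.

Definition last_sign (s : bool) (i : axis) : bool := match i with I3 => s | _ => false end.

(* The twelve representatives of Gamma / PSL(2,L); the first four also represent
   Gamma / PSL(2,H). *)
Definition rep (m : nat) : quat -> quat :=
  sp (perm_of_nat (Nat.div2 m)) (last_sign (Nat.odd m)).

Lemma perm_perm_of_nat (n : nat) : perm (perm_of_nat n).
Proof.
do 5 (destruct n as [| n]; [intros [] []; simpl; congruence |]).
intros [] []; simpl; congruence.
Qed.

Lemma perm_of_nat_surj (p : axis -> axis) : perm p ->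
  exists n, (n < 6)%nat /\ forall i, p i = perm_of_nat n i.
Proof.
intros Hp; perm_cases p Hp;
  [exists 0%nat | exists 2%nat | exists 1%nat | exists 3%nat | exists 4%nat | exists 5%nat];
  (split; [lia | intros []; assumption]).
Qed.

Lemma rep_double (n : nat) (s : bool) : (n < 6)%nat ->
  rep (2 * n + if s then 1 else 0) = sp (perm_of_nat n) (last_sign s).
Proof.
intros Hn; do 6 (destruct n as [| n]; [destruct s; reflexivity |]); lia.
Qed.

Lemma Gamma_rep (m : nat) : Gamma3434 (rep m).
Proof. apply Gamma_sp, perm_perm_of_nat. Qed.

Lemma lab_rep (m : nat) : lab (rep m) (perm_of_nat (Nat.div2 m))
  (sp_sign (perm_of_nat (Nat.div2 m)) (last_sign (Nat.odd m))).
Proof. apply lab_sp, perm_perm_of_nat. Qed.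

Lemma even_signs_perm (p : axis -> axis) (c : axis -> bool) : perm p ->
  even_signs (fun i => c (p i)) -> even_signs c.
Proof.
unfold even_signs; intros Hp; perm_cases p Hp; destruct (c I1), (c I2), (c I3);
  simpl; congruence.
Qed.

Lemma even_signs_last (b : axis -> bool) :
  even_signs (fun i => xorb (last_sign (xorb (b I1) (xorb (b I2) (b I3))) i) (b i)).
Proof. unfold even_signs; simpl; destruct (b I1), (b I2), (b I3); reflexivity. Qed.

(** One sign on the third axis absorbs the parity of [b], so the remaining signs are even. With [p1]
    the identity the right factor lies in PSL(2,L), with [p1] cyclic in PSL(2,H). *)
Lemma sp_factor (p p0 p1 : axis -> axis) (b : axis -> bool) : perm p0 ->
  (forall i, p i = p1 (p0 i)) ->
  exists s c, even_signs c /\ forall q, sp p b q = sp p0 (last_sign s) (sp p1 c q).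
Proof.
intros H0 E; destruct (perm_inv p0 H0) as (p0' & _ & E1 & E2).
exists (xorb (b I1) (xorb (b I2) (b I3))),
  (fun i => xorb (last_sign (xorb (b I1) (xorb (b I2) (b I3))) (p0' i)) (b (p0' i))).
split.
- apply (even_signs_perm p0); trivial.
  pose proof (even_signs_last b) as K; unfold even_signs in *; rewrite !E2; exact K.
- intros q; rewrite sp_comp; apply sp_ext; [exact E |].
  intros i; rewrite E2, <- xorb_assoc, xorb_nilpotent, xorb_false_l; reflexivity.
Qed.

Lemma index_Gamma_PSL2L : index_eq Gamma3434 PSL2L 12.
Proof.
exists rep; split; [intros i _; apply Gamma_rep | split].
- intros g Gg; destruct (Gamma_normal_form g Gg) as (p & b & k & Hp & Hk & E).
  destruct (perm_of_nat_surj p Hp) as (n & Hn & En).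
  destruct (sp_factor p (perm_of_nat n) (fun i => i) b (perm_perm_of_nat n) En)
    as (s & c & Hc & Es).
  exists (2 * n + if s then 1 else 0)%nat, (compose (sp (fun i => i) c) k).
  split; [destruct s; lia | split].
  + apply PSL2L_compose; [apply PSL2L_even_signs, Hc | exact Hk].
  + intros q Hq; rewrite E by trivial; unfold compose; rewrite rep_double by trivial; apply Es.
- intros i j k k' Hi Hj Hij Hk Hk' E.
  pose proof (lab_compose _ _ _ _ _ _ (PSL2L_preservesH k Hk) (lab_rep i) (PSL2L_lab k Hk)) as L.
  pose proof (lab_compose _ _ _ _ _ _ (PSL2L_preservesH k' Hk') (lab_rep j) (PSL2L_lab k' Hk'))
    as L'.
  apply (lab_eqH _ _ _ _ E) in L'.
  destruct (lab_unique _ _ _ _ _ (perm_perm_of_nat _) L L') as [Ep Es].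
  (* Two values determine a permutation. Representatives with the same permutation differ in one
     sign, hence in the determinant. *)
  clear E L L'; pose proof (Ep I1) as E1; pose proof (Ep I2) as E2; clear Ep.
  do 12 (destruct i as [| i];
    [do 12 (destruct j as [| j]; [simpl in E1, E2, Es; congruence || (exfalso; lia) |]); lia |]).
  lia.
Qed.

Lemma index_Gamma_PSL2H : index_eq Gamma3434 PSL2H 4.
Proof.
exists rep; split; [intros i _; apply Gamma_rep | split].
- intros g Gg; destruct (Gamma_normal_form g Gg) as (p & b & k & Hp & Hk & E).
  assert (K : exists n p1, (n < 2)%nat /\ cyc p1 /\ forall i, p i = p1 (perm_of_nat n i)).
  { perm_cases p Hp;
    first [ exists 0%nat, p; split; [lia | split; intros []]; simpl; rewrite ?P1, ?P2, ?P3;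
            reflexivity
          | exists 1%nat, (fun i => p (swap12 i)); split; [lia | split; intros []];
            simpl; rewrite ?P1, ?P2, ?P3; reflexivity ]. }
  destruct K as (n & p1 & Hn & Hp1 & Ep).
  destruct (sp_factor p (perm_of_nat n) p1 b (perm_perm_of_nat n) Ep) as (s & c & Hc & Es).
  exists (2 * n + if s then 1 else 0)%nat, (compose (sp p1 c) k).
  split; [destruct s; lia | split].
  + apply PSL2H_compose; [apply PSL2H_rotation; trivial | apply PSL2L_sub_PSL2H, Hk].
  + intros q Hq; rewrite E by trivial; unfold compose; rewrite rep_double by lia; apply Es.
- intros i j k k' Hi Hj Hij Hk Hk' E.
  destruct (PSL2H_lab k Hk) as (p & Hp & Lk), (PSL2H_lab k' Hk') as (p' & Hp' & Lk').
  pose proof (generated_preservesH _ _ gens_PSL2H_preservesH Hk) as Pk.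
  pose proof (generated_preservesH _ _ gens_PSL2H_preservesH Hk') as Pk'.
  pose proof (lab_compose _ _ _ _ _ _ Pk (lab_rep i) Lk) as L.
  pose proof (lab_compose _ _ _ _ _ _ Pk' (lab_rep j) Lk') as L'.
  apply (lab_eqH _ _ _ _ E) in L'.
  destruct (lab_unique _ _ _ _ _ (perm_compose _ _ (cyc_perm _ Hp') (perm_perm_of_nat _)) L L')
    as [Ep Es].
  (* The determinants of the four representatives are 1, -1, -1, 1. Two with equal determinant
     differ by a transposition, which would have to equal a cyclic permutation. *)
  clear E L L'; pose proof (Ep I1) as E1; pose proof (Ep I2) as E2; clear Ep.
  pose proof (Hp I1) as A1; pose proof (Hp' I1) as A1'; simpl in A1, A1'.
  do 4 (destruct i as [| i];
    [do 4 (destruct j as [| j]; [simpl in E1, E2, Es;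
       (try discriminate Es); (try (exfalso; lia));
       exfalso; rewrite ?A1, ?A1' in *; destruct (p I1), (p' I1); simpl in *; congruence |]); lia |]).
  lia.
Qed.

(** All determinants are 1 here; the three cosets are told apart by the permutation of the radical
    alone. *)
Lemma index_PSL2H_PSL2L : index_eq PSL2H PSL2L 3.
Proof.
pose (r := fun m : nat => match m with 0 => fun i => i | 1 => next | _ => fun i => next (next i) end).
assert (Cr : forall m, cyc (r m)) by (intros [| [|]] []; reflexivity).
exists (fun m => sp (r m) (fun _ => false)); split; [| split].
- intros i _; apply PSL2H_rotation; [apply Cr | reflexivity].
- intros g Hg; destruct (PSL2H_normal_form g Hg) as (p & b & k & Hp & Hc & Hk & E).
  assert (K : exists n, (n < 3)%nat /\ forall i, p i = r n i).
  { pose proof (Hp I1) as H1; pose proof (Hp I2) as H2; simpl in H1, H2.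
    destruct (p I1) eqn:E1; simpl in H1; rewrite H1 in H2; simpl in H2;
      [exists 0%nat | exists 1%nat | exists 2%nat]; (split; [lia | intros []; simpl; congruence]). }
  destruct K as (n & Hn & En).
  destruct (perm_inv (r n) (cyc_perm _ (Cr n))) as (p' & _ & _ & E2).
  exists n, (compose (sp (fun i => i) (fun i => b (p' i))) k); split; [exact Hn | split].
  + apply PSL2L_compose; [| exact Hk]; apply PSL2L_even_signs.
    apply (even_signs_perm (r n)); [apply cyc_perm, Cr |].
    unfold even_signs in *; rewrite !E2; exact Hc.
  + intros q Hq; rewrite E by trivial; unfold compose; rewrite sp_comp.
    apply sp_ext; [exact En | intros i; rewrite E2; symmetry; apply xorb_false_l].
- intros i j k k' Hi Hj Hij Hk Hk' E.
  assert (Lr : forall m, lab (sp (r m) (fun _ => false)) (r m) (sp_sign (r m) (fun _ => false)))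
    by (intros m; apply lab_sp, cyc_perm, Cr).
  pose proof (lab_compose _ _ _ _ _ _ (PSL2L_preservesH k Hk) (Lr i) (PSL2L_lab k Hk)) as L.
  pose proof (lab_compose _ _ _ _ _ _ (PSL2L_preservesH k' Hk') (Lr j) (PSL2L_lab k' Hk')) as L'.
  apply (lab_eqH _ _ _ _ E) in L'.
  destruct (lab_unique _ _ _ _ _ (cyc_perm _ (Cr j)) L L') as [Ep _].
  specialize (Ep I1).
  destruct i as [| [| [|]]], j as [| [| [|]]]; simpl in Ep; (congruence || lia).
Qed.

Theorem mainTheorem12 :
  (forall g, Gamma3434 g -> isometry g) /\
  discrete_group Gamma3434 /\ finite_covolume Gamma3434 /\
  subgroup PSL2L PSL2H /\ subgroup PSL2H Gamma3434 /\
  index_eq Gamma3434 PSL2H 4 /\ index_eq Gamma3434 PSL2L 12 /\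
  index_eq PSL2H PSL2L 3.
Proof.
split; [exact Gamma_isometry |].
split; [exact Gamma_discrete |].
split; [exact Gamma_finite_covolume |].
split; [exact PSL2L_sub_PSL2H |].
split; [exact PSL2H_sub_Gamma |].
split; [exact index_Gamma_PSL2H |].
split; [exact index_Gamma_PSL2L | exact index_PSL2H_PSL2L].
Qed.
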